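(* Consider the composite optimization problem $$\text{minimize }\ \varphi_0(x)+(\vartheta\circ f)(x)\ \text{ over }x\in\mathbb{R}^n,\qquad(\mathrm{P})$$ and assume that $\varphi_0\colon\mathbb{R}^n\to\mathbb{R}$ and $f\colon\mathbb{R}^n\to\mathbb{R}^m$ are $\mathcal{C}^2$-smooth around $\bar x$, and that $\vartheta\colon\mathbb{R}^m\to\overline{\mathbb{R}}$ is convex piecewise linear-quadratic with $f(\bar x)\in\operatorname{dom}\vartheta$. Let $(\bar x,\bar\lambda)$ be a solution to the KKT system $\nabla_xL(x,\lambda)=0$, $\lambda\in\partial\vartheta(f(x))$. Define $G\colon\mathbb{R}^n\times\mathbb{R}^m\rightrightarrows\mathbb{R}^n\times\mathbb{R}^m$ by $$G(x,\lambda):=\begin{bmatrix}\nabla_xL(x,\lambda)\\-f(x)\end{bmatrix}+\begin{bmatrix}0\\(\partial\vartheta)^{-1}(\lambda)\end{bmatrix}.$$ Then the following conditions are equivalent: (i) The mapping $G$ is strongly metrically subregular at $((\bar x,\bar\lambda),(0,0))$, and $\bar x$ is a local minimizer for (P). (ii) $\Lambda(\bar x,\bar v)=\{\bar\lambda\}$ with $\bar v:=-\nabla\varphi_0(\bar x)$, and the second-order sufficient condition $$\mathrm{d}^2\vartheta\big(f(\bar x),\bar\lambda\big)\big(\nabla f(\bar x)w\big)+\langle\nabla^2_{xx}L(\bar x,\bar\lambda)w,w\rangle>0$$ holds for all $w\in\mathbb{R}^n\setminus\{0\}$ satisfying $\nabla f(\bar x)w\in K_\vartheta(f(\bar x),\bar\lambda)$.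 (iii) The second-order sufficient condition displayed in (ii) (for all $w\in\mathbb{R}^n\setminus\{0\}$ with $\nabla f(\bar x)w\in K_\vartheta(f(\bar x),\bar\lambda)$) and the strong Robinson constraint qualification $$\big(D\partial\vartheta\big)\big(f(\bar x),\bar\lambda\big)(0)\cap\ker\nabla f(\bar x)^*=\{0\}$$ are both satisfied.
   Context: $\overline{\mathbb{R}}:=(-\infty,\infty]$, $\operatorname{dom}\vartheta:=\{y\mid\vartheta(y)<\infty\}$; $^*$ on matrices denotes transpose. The Lagrangian is $L(x,\lambda):=\varphi_0(x)+\langle\lambda,f(x)\rangle-\vartheta^*(\lambda)$, with $\vartheta^*$ the Fenchel conjugate; thus $\nabla_xL(x,\lambda)=\nabla\varphi_0(x)+\nabla f(x)^*\lambda$ and $\nabla^2_{xx}L(x,\lambda)=\nabla^2\varphi_0(x)+\nabla^2\langle\lambda,f\rangle(x)$. Multiplier set: $\Lambda(\bar x,\bar v):=\{\lambda\in\mathbb{R}^m\mid\nabla f(\bar x)^*\lambda=\bar v,\ \lambda\in\partial\vartheta(f(\bar x))\}$. $\vartheta$ is piecewise linear-quadratic if $\operatorname{dom}\vartheta=\bigcup_{i=1}^s\Omega_i$ with polyhedral convex sets $\Omega_i$ and $\vartheta(y)=\frac12\langle A_iy,y\rangle+\langle a_i,y\rangle+\alpha_i$ for $y\in\Omega_i$, with symmetric matrices $A_i$, $a_i\in\mathbb{R}^m$, $\alpha_i\in\mathbb{R}$. $\partial\vartheta$ is the subdifferential of convex analysis. Subderivative: $\mathrm{d}\vartheta(\bar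 y)(\bar w):=\liminf_{t\downarrow 0,\,w\to\bar w}\frac{\vartheta(\bar y+tw)-\vartheta(\bar y)}{t}$. Second subderivative: $\mathrm{d}^2\vartheta(\bar y,\bar u)(w):=\liminf_{t\downarrow0,\,w'\to w}\frac{\vartheta(\bar y+tw')-\vartheta(\bar y)-t\langle\bar u,w'\rangle}{\frac12t^2}$. Critical cone: $K_\vartheta(\bar y,\bar u):=\{w\mid\mathrm{d}\vartheta(\bar y)(w)=\langle\bar u,w\rangle\}$. Tangent cone: $T_\Omega(\bar x):=\{w\mid\exists\,t_k\downarrow0,\ w_k\to w,\ \bar x+t_kw_k\in\Omega\}$. Graphical derivative of a set-valued mapping $S$ at $(\bar x,\bar y)\in\operatorname{gph}S$: $DS(\bar x,\bar y)(u):=\{v\mid(u,v)\in T_{\operatorname{gph}S}(\bar x,\bar y)\}$. $S$ is strongly metrically subregular at $(\bar x,\bar y)\in\operatorname{gph}S$ if there are $\kappa\ge0$ and a neighborhood $U$ of $\bar x$ with $\|x-\bar x\|\le\kappa\operatorname{dist}(\bar y;S(x))$ for all $x\in U$ (with $\operatorname{dist}(\bar y;\emptyset)=\infty$). *)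

(* Defs.v *)
From HB Require Import structures.
From mathcomp Require Import all_boot all_order all_algebra.
From mathcomp Require Import all_classical all_reals all_analysis.

Set Implicit Arguments.
Unset Strict Implicit.
Unset Printing Implicit Defensive.

Import Order.TTheory GRing.Theory Num.Theory.
Import numFieldNormedType.Exports.

Local Open Scope classical_set_scope.
Local Open Scope ring_scope.

(* R^n is 'rV[R]_n with the library's sup norm, and products carry the max
   norm. The notions below that mention a norm (neighbourhoods, limits, strong
   metric subregularity with an unspecified constant) do not depend on which
   norm of a finite-dimensional space is used.

   Vectors are rows and 'J f x is the matrix with 'd f x w = w *m 'J f x, i.e.
   the transpose of the usual Jacobian matrix. Hence
     nabla f(x) w        is  w *m 'J f x,
     nabla f(x)^* lambda is  lambda *m ('J f x)^T,
     A w                 is  w *m A  for a symmetric matrix A. *)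

Definition dotr (R : realType) (n : nat) (u v : 'rV[R]_n) : R :=
  \sum_(i < n) u 0 i * v 0 i.

Definition gradient (R : realType) (n : nat) (phi : 'rV[R]_n -> R)
    (x : 'rV[R]_n) : 'rV[R]_n :=
  \row_(i < n) 'D_(delta_mx 0 i) phi x.

Definition hessian (R : realType) (n : nat) (phi : 'rV[R]_n -> R)
    (x : 'rV[R]_n) : 'M[R]_n :=
  \matrix_(i < n, j < n) 'D_(delta_mx 0 i) ('D_(delta_mx 0 j) phi) x.

Definition C2_around (R : realType) (n : nat) (W : normedModType R)
    (f : 'rV[R]_n -> W) (x : 'rV[R]_n) : Prop :=
  \forall y \near x,
    [/\ differentiable f y,
        forall v, differentiable ('D_v f) y &
        forall u v, {for y, continuous ('D_u ('D_v f))}].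

Section ExtendedRealFunctions.
Context (R : realType) (m : nat).
Implicit Types (theta : 'rV[R]_m -> \bar R) (y u w : 'rV[R]_m).

Definition edom theta : set 'rV[R]_m := [set y | (theta y < +oo)%E].

Definition econvex theta : Prop :=
  forall y z (t : R), 0 < t < 1 ->
    (theta (t *: y + (1 - t) *: z)%R
       <= t%:E * theta y + (1 - t)%:E * theta z)%E.

Definition polyhedral (Omega : set 'rV[R]_m) : Prop :=
  exists (k : nat) (b : 'I_k -> 'rV[R]_m) (beta : 'I_k -> R),
    Omega = [set y | forall i, dotr (b i) y <= beta i].

Definition piecewise_linear_quadratic theta : Prop :=
  exists (s : nat) (Omega : 'I_s -> set 'rV[R]_m) (A : 'I_s -> 'M[R]_m)
         (a : 'I_s -> 'rV[R]_m) (alpha : 'I_s -> R),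
    [/\ forall i, polyhedral (Omega i),
        forall i, (A i)^T = A i,
        edom theta = \bigcup_i Omega i &
        forall i y, Omega i y ->
          theta y = (2^-1 * dotr (y *m A i) y + dotr (a i) y + alpha i)%:E].

Definition subdifferential theta y : set 'rV[R]_m :=
  [set u | edom theta y /\
     forall z, (theta y + (dotr u (z - y)%R)%:E <= theta z)%E].

Definition subderivative theta y w : \bar R :=
  limf_einf
    (fun p : R * 'rV[R]_m =>
       (p.1^-1%:E * (theta (y + p.1 *: p.2)%R - theta y))%E)
    (filter_prod 0^'+ (nbhs w)).

Definition second_subderivative theta y u w : \bar R :=
  limf_einf
    (fun p : R * 'rV[R]_m =>
       ((2^-1 * p.1 ^+ 2)^-1%:E *
        (theta (y + p.1 *: p.2)%R - theta y - (p.1 * dotr u p.2)%:E))%E)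
    (filter_prod 0^'+ (nbhs w)).

Definition critical_cone theta y u : set 'rV[R]_m :=
  [set w | subderivative theta y w = (dotr u w)%:E].

End ExtendedRealFunctions.

Section SetValuedMappings.
Context (R : realType).
Implicit Types V W : normedModType R.

Definition tangent_cone V (Omega : set V) (x : V) : set V :=
  [set w | exists (t : nat -> R) (w_ : nat -> V),
     [/\ forall k, 0 < t k, t @ \oo --> (0 : R), w_ @ \oo --> w &
         forall k, Omega (x + t k *: w_ k)]].

Definition gph V W (S : V -> set W) : set (V * W) := [set p | S p.1 p.2].

Definition set_inverse V W (S : V -> set W) : W -> set V :=
  fun y => [set x | S x y].

Definition graphical_derivative V W (S : V -> set W) (x : V) (y : W) :
    V -> set W :=
  fun u => [set v | tangent_cone (gph S) (x, y) (u, v)].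

Definition edist_set V (y : V) (A : set V) : \bar R :=
  ereal_inf [set `|y - z|%:E | z in A].

(* In \bar R, 0 * +oo = 0; this is harmless as kappa may always be enlarged. *)
Definition strongly_metrically_subregular V W (S : V -> set W) (x : V) (y : W)
    : Prop :=
  gph S (x, y) /\
  exists2 kappa : R, 0 <= kappa &
    \forall x' \near x, (`|x' - x|%:E <= kappa%:E * edist_set y (S x'))%E.

End SetValuedMappings.

Section CompositeProblem.
Context (R : realType) (n m : nat).
Variables (phi0 : 'rV[R]_n -> R) (theta : 'rV[R]_m -> \bar R)
  (f : 'rV[R]_n -> 'rV[R]_m).
Implicit Types (x : 'rV[R]_n) (lambda : 'rV[R]_m).

(* Derivatives in x of L(x, lambda) = phi0 x + <lambda, f x> - theta^* lambda,
   in which the term theta^* lambda does not depend on x. *)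
Definition grad_lagrangian x lambda : 'rV[R]_n :=
  gradient phi0 x + lambda *m ('J f x)^T.

Definition hess_lagrangian x lambda : 'M[R]_n :=
  hessian phi0 x + hessian (fun z => dotr lambda (f z)) x.

Definition multipliers x (v : 'rV[R]_n) : set 'rV[R]_m :=
  [set lambda | lambda *m ('J f x)^T = v /\
                subdifferential theta (f x) lambda].

Definition KKT_mapping (p : 'rV[R]_n * 'rV[R]_m) : set ('rV[R]_n * 'rV[R]_m) :=
  [set (grad_lagrangian p.1 p.2, - f p.1 + y)
    | y in set_inverse (subdifferential theta) p.2].

Definition local_minimizer x : Prop :=
  \forall x' \near x,
    ((phi0 x)%:E + theta (f x) <= (phi0 x')%:E + theta (f x'))%E.

Definition second_order_sufficient x lambda : Prop :=
  forall w : 'rV[R]_n, w != 0 ->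
    critical_cone theta (f x) lambda (w *m 'J f x) ->
    (0 < second_subderivative theta (f x) lambda (w *m 'J f x)%R
         + (dotr (w *m hess_lagrangian x lambda) w)%:E)%E.

Definition strong_Robinson_CQ x lambda : Prop :=
  graphical_derivative (subdifferential theta) (f x) lambda 0
    `&` [set mu | mu *m ('J f x)^T = 0] = [set 0].

End CompositeProblem.

(* Main.v *)
Require Import Defs.
From HB Require Import structures.
From mathcomp Require Import all_boot all_order all_algebra.
From mathcomp Require Import all_classical all_reals all_analysis.
From mathcomp Require Import ring lra.
Import Order.TTheory GRing.Theory Num.Theory.
Import numFieldNormedType.Exports.
Local Open Scope classical_set_scope.
Local Open Scope ring_scope.

(** Write [ybar = f xbar], [ell x = phi0 x + <lambda, f x>] for the Lagrangian at
  the given multiplier, and [gap y] for the excess of [theta y] over its affine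
  minorant of slope [lambda] at [ybar]. Up to a constant the objective of the
  problem is [ell x + gap (f x)], where [ell] is stationary at [xbar] with Hessian
  [H], and [gap] is nonnegative, convex and piecewise linear-quadratic, with the
  second subderivative of [theta] as its second-order lower limit. Compactness
  enters by coverings ([compact_eventually]): a property that holds near each
  point of a sphere holds uniformly on it.

  From the second-order condition and the constraint qualification to
  subregularity and local minimality: adding second-order lower bounds for [ell]
  and [gap] shows growth in every direction, hence local minimality
  ([sosc_local_minimizer]). For subregularity the generalized equation is blown up
  at the base point ([sosc_blowup]). A failure produces a unit pair [(w, mu)] with
  [w H + mu J^T = 0] and [mu] in the graphical derivative of the subdifferential
  at [w J]. For a piecewise linear-quadratic function such a [mu] satisfies
  [d2 theta (w J) <= <mu, w J> = - <w H, w>]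
  ([second_subderivative_le_derivative]), which contradicts the second-order
  condition unless [w = 0]; in that case [mu] contradicts the constraint
  qualification.

  From a unique multiplier to the constraint qualification: by Farkas' lemma on
  each polyhedral piece, an element [mu] of the graphical derivative at direction
  [0] is such that [lambda + s mu] is a subgradient at [ybar] for some [s > 0]
  ([derivative_subgradient]); if moreover [mu J^T = 0], then [lambda + s mu] is a
  multiplier, hence [mu = 0].

  From subregularity and local minimality to the second-order condition:
  multipliers form a convex set, and a segment of them would consist of zeros of
  the mapping ([subregular_unique_multiplier]). Next, the constraint [y = f x] is
  penalized quadratically. The minimizers of
  [ell x + gap y + rho / 2 |f x - y|^2 + eta |x - xbar|^2] near [(xbar, ybar)] solve
  a perturbation of the generalized equation, with residuals so small compared
  with their distance to [(xbar, lambda)] that subregularity leaves no other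
  minimizer than [(xbar, ybar)]: the penalty is exact ([exact_penalty]). If the
  second-order condition fails at [w], adding the squared distance to the test
  point [(xbar + t w, ybar + t w')] and minimizing again gives points at a distance
  of order [t] from [xbar] that solve the generalized equation up to residuals of
  order [sigma t] with [sigma] as small as desired, which contradicts
  subregularity ([subregular_sosc]). *)

Set Implicit Arguments.
Unset Strict Implicit.
Unset Printing Implicit Defensive.

(** * Dot product, Farkas' lemma, convergence of vectors and matrices *)

Section DotProduct.
Context {R : realType}.

Lemma dotrE n (u v : 'rV[R]_n) : dotr u v = (u *m v^T) 0 0.
Proof. by rewrite /dotr mxE; apply: eq_bigr => i _; rewrite mxE. Qed.

Lemma dotrC n (u v : 'rV[R]_n) : dotr u v = dotr v u.
Proof. by apply: eq_bigr => i _; rewrite mulrC. Qed.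

Lemma dotrDl n (u v w : 'rV[R]_n) : dotr (u + v) w = dotr u w + dotr v w.
Proof. by rewrite !dotrE mulmxDl mxE. Qed.

Lemma dotrDr n (u v w : 'rV[R]_n) : dotr w (u + v) = dotr w u + dotr w v.
Proof. by rewrite dotrC dotrDl !(dotrC w). Qed.

Lemma dotrZl n a (u v : 'rV[R]_n) : dotr (a *: u) v = a * dotr u v.
Proof. by rewrite !dotrE -scalemxAl mxE. Qed.

Lemma dotrZr n a (u v : 'rV[R]_n) : dotr v (a *: u) = a * dotr v u.
Proof. by rewrite dotrC dotrZl dotrC. Qed.

Lemma dotrNl n (u v : 'rV[R]_n) : dotr (- u) v = - dotr u v.
Proof. by rewrite -scaleN1r dotrZl mulN1r. Qed.

Lemma dotrNr n (u v : 'rV[R]_n) : dotr v (- u) = - dotr v u.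
Proof. by rewrite dotrC dotrNl dotrC. Qed.

Lemma dotr0l n (u : 'rV[R]_n) : dotr 0 u = 0.
Proof. by rewrite -(scale0r 0) dotrZl mul0r. Qed.

Lemma dotr0r n (u : 'rV[R]_n) : dotr u 0 = 0.
Proof. by rewrite dotrC dotr0l. Qed.

Definition dotrB := (dotrDl, dotrDr, dotrNl, dotrNr).
Definition dotr_lin := (dotrB, dotrZl, dotrZr, dotr0l, dotr0r).

Lemma dotr_mulmx m n (u : 'rV[R]_m) (A : 'M[R]_(m, n)) v :
  dotr (u *m A) v = dotr u (v *m A^T).
Proof. by rewrite !dotrE trmx_mul trmxK mulmxA. Qed.

Lemma dotr_sumr n I (r : seq I) (F : I -> 'rV[R]_n) (u : 'rV[R]_n) :
  dotr u (\sum_(i <- r) F i) = \sum_(i <- r) dotr u (F i).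
Proof.
by elim: r => [|i r IH]; rewrite ?big_nil ?dotr0r// !big_cons dotrDr IH.
Qed.

Lemma dotr_ge0 n (u : 'rV[R]_n) : 0 <= dotr u u.
Proof. by apply: sumr_ge0 => i _; rewrite -expr2 sqr_ge0. Qed.

Lemma coord_le_norm n (u : 'rV[R]_n) i : `|u 0 i| <= `|u|.
Proof.
rewrite [leRHS]mx_normrE.
by apply: (le_trans _ (le_bigmax _ _ (0, i))).
Qed.

Lemma row_norm_le n (u : 'rV[R]_n) e :
  0 <= e -> (forall i, `|u 0 i| <= e) -> `|u| <= e.
Proof.
move=> e0 ue; rewrite [leLHS]mx_normrE; apply/bigmax_leP; split=> //.
by case=> i j _ /=; rewrite ord1.
Qed.

Lemma normsq_le_dotr n (u : 'rV[R]_n) : `|u| ^+ 2 <= dotr u u.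
Proof.
have : `|u| <= Num.sqrt (dotr u u).
  apply: row_norm_le => [|i]; first exact: sqrtr_ge0.
  rewrite -sqrtr_sqr ler_wsqrtr// /dotr (bigD1 i)//= -expr2 lerDl.
  by apply: sumr_ge0 => j _; rewrite -expr2 sqr_ge0.
move=> /(lerXn2r 2 (normr_ge0 _) (sqrtr_ge0 _))/le_trans; apply.
by rewrite sqr_sqrtr ?dotr_ge0.
Qed.

Lemma dotr_eq0 n (u : 'rV[R]_n) : dotr u u = 0 -> u = 0.
Proof.
move=> u0; apply/eqP; rewrite -normr_eq0 -sqrf_eq0 eq_le sqr_ge0 andbT.
by rewrite -u0 normsq_le_dotr.
Qed.

Lemma dotr_gt0 n (u : 'rV[R]_n) : u != 0 -> 0 < dotr u u.
Proof.
move=> u0; rewrite lt_neqAle dotr_ge0 andbT eq_sym.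
by apply: contraNneq u0 => /dotr_eq0 ->.
Qed.

Lemma dotr_norm_le n (u v : 'rV[R]_n) : `|dotr u v| <= n%:R * (`|u| * `|v|).
Proof.
apply: le_trans (ler_norm_sum _ _ _) _.
have -> : n%:R * (`|u| * `|v|) = \sum_(i < n) `|u| * `|v|.
  by rewrite sumr_const card_ord mulr_natl.
by apply: ler_sum => i _; rewrite normrM ler_pM// coord_le_norm.
Qed.

End DotProduct.

Section Farkas.
Context {R : realType} {n : nat}.

(** Induction on the number of generators. If a point [w0] satisfies the first
  [k] inequalities but not the conclusion, it violates the last one. Projecting
  along the last generator [z] onto the hyperplane orthogonal to [w0] reduces the
  statement to the projections of the first [k] generators; the coefficient of
  [z] in the resulting combination is nonnegative by the signs at [w0]. *)
Lemma farkas k (a : 'I_k -> 'rV[R]_n) (c : 'rV[R]_n) :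
  (forall w, (forall i, 0 <= dotr (a i) w) -> 0 <= dotr c w) ->
  exists2 b : 'I_k -> R, (forall i, 0 <= b i) & c = \sum_i b i *: a i.
Proof.
elim: k a c => [a c acP|k IH a c acP].
  exists (fun=> 0) => //; rewrite big_ord0.
  have /acP : forall i : 'I_0, 0 <= dotr (a i) (- c) by case.
  by rewrite dotrNr oppr_ge0 => c0; apply: dotr_eq0; apply/le_anti/andP;
    split=> //; exact: dotr_ge0.
pose a' i := a (widen_ord (leqnSn k) i).
have [a'P|] := pselect (forall w, (forall i, 0 <= dotr (a' i) w) ->
                                  0 <= dotr c w).
  have [b b0 ->] := IH a' c a'P.
  exists (fun i => if unlift ord_max i is Some j then b j else 0).
    by move=> i; case: unliftP => //= j _; exact: b0.
  rewrite big_ord_recr/= unlift_none scale0r addr0; apply: eq_bigr => i _.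
  have -> : widen_ord (leqnSn k) i = lift ord_max i.
    by apply: val_inj; rewrite /= /bump leqNgt ltn_ord.
  rewrite liftK /a'; congr (_ *: a _); apply: val_inj.
  by rewrite /= /bump leqNgt ltn_ord.
move=> /existsNP[w0 /not_implyP[a'w0 /negP]]; rewrite -ltNge => cw0.
pose z := a ord_max.
have zw0 : dotr z w0 < 0.
  rewrite ltNge; apply/negP => zw0; have /acP : forall i, 0 <= dotr (a i) w0.
    move=> i; have [j ->|->//] := unliftP ord_max i.
    have := a'w0 j; rewrite /a'; congr (0 <= dotr (a _) _); apply: val_inj.
    by rewrite /= /bump leqNgt ltn_ord.
  by rewrite leNgt cw0.
pose s := - (dotr z w0)^-1.
have s0 : 0 < s by rewrite oppr_gt0 invr_lt0.
pose pr v : 'rV[R]_n := v + (s * dotr v w0) *: z.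
(* The adjoint of [pr] projects test points along [w0] onto the hyperplane
  orthogonal to [z], so the last inequality holds with equality there. *)
have prE v w : dotr (pr v) w = dotr v (w + (s * dotr z w) *: w0).
  rewrite /pr !dotr_lin; ring.
have [w|b b0 cE] := IH (pr \o a') (pr c).
  move=> /= aw; rewrite prE; apply: acP => i.
  have [j ->|->] := unliftP ord_max i.
    have := aw j; rewrite prE /a'.
    by congr (0 <= dotr (a _) _); apply: val_inj; rewrite /= /bump leqNgt ltn_ord.
  rewrite -/z dotrDr dotrZr mulrAC /s.
  by rewrite !mulNr mulVf ?lt_eqF// mul1r subrr.
pose t := \sum_i b i * (s * dotr (a' i) w0) - s * dotr c w0.
exists (fun i => if unlift ord_max i is Some j then b j else t).
  move=> i; case: unliftP => [j _|_]; first exact: b0.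
  rewrite /t -mulrN addr_ge0//; first by apply: sumr_ge0 => j _; rewrite !mulr_ge0 ?(ltW s0)//.
  apply: mulr_ge0; [exact: ltW|rewrite oppr_ge0; exact: ltW].
rewrite big_ord_recr/= unlift_none -/z.
have -> : \sum_(i < k) (if unlift ord_max (widen_ord (leqnSn k) i) is Some j
            then b j else t) *: a (widen_ord (leqnSn k) i)
        = \sum_i b i *: a' i.
  apply: eq_bigr => i _; have -> : widen_ord (leqnSn k) i = lift ord_max i.
    by apply: val_inj; rewrite /= /bump leqNgt ltn_ord.
  rewrite liftK /a'; congr (_ *: a _); apply: val_inj.
  by rewrite /= /bump leqNgt ltn_ord.
rewrite /t scalerBl scaler_suml addrA -big_split/=.
apply/(canRL (subrK _)); rewrite opprK -[LHS]/(pr c) cE.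
by apply: eq_bigr => i _; rewrite /pr scalerDr scalerA.
Qed.

End Farkas.

Section Convergence.
Context {R : realType}.

Lemma cvg_mx {T} (F : set_system T) {FF : Filter F} m n
    (u : T -> 'M[R]_(m, n)) (a : 'M[R]_(m, n)) :
  (forall i j, (fun x => u x i j) @ F --> a i j) -> u @ F --> a.
Proof.
move=> ua; apply/cvgrPdist_le => /= e e0.
have : \forall x \near F, forall ij, `|a ij.1 ij.2 - u x ij.1 ij.2| <= e.
  apply: filter_forall => ij; move/cvgrPdist_le: (ua ij.1 ij.2); exact.
apply: filterS => x ux; rewrite [leLHS]mx_normrE bigmax_le ?(ltW e0)//= => ij _.
by rewrite !mxE.
Qed.

Lemma cvg_row {T} (F : set_system T) {FF : Filter F} n (u : T -> 'rV[R]_n)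
    (a : 'rV[R]_n) :
  (forall i, (fun x => u x 0 i) @ F --> a 0 i) -> u @ F --> a.
Proof. by move=> ua; apply: cvg_mx => i j; rewrite !ord1; exact: ua. Qed.

Lemma cvg_coord {T} (F : set_system T) {FF : Filter F} m n
    (u : T -> 'M[R]_(m, n)) (a : 'M[R]_(m, n)) i j :
  u @ F --> a -> (fun x => u x i j) @ F --> a i j.
Proof.
move=> ua; apply: (@cvg_comp _ _ _ u (fun M : 'M[R]_(m, n) => M i j) _ _ _ ua).
exact: coord_continuous.
Qed.

Lemma cvg_sum_ord {T} (F : set_system T) {FF : Filter F} n (u : 'I_n -> T -> R)
    (a : 'I_n -> R) :
  (forall i, u i @ F --> a i) -> (fun x => \sum_i u i x) @ F --> \sum_i a i.
Proof. by move=> ua; apply: cvg_big => //; apply: add_continuous. Qed.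

Lemma cvg_dotr {T} (F : set_system T) {FF : Filter F} n (u v : T -> 'rV[R]_n)
    (a b : 'rV[R]_n) :
  u @ F --> a -> v @ F --> b -> (fun x => dotr (u x) (v x)) @ F --> dotr a b.
Proof.
by move=> ua vb; apply: cvg_sum_ord => i; apply: cvgM; apply: cvg_coord.
Qed.

Lemma cvg_mulmx {T} (F : set_system T) {FF : Filter F} m n
    (u : T -> 'rV[R]_m) (A : T -> 'M[R]_(m, n)) (a : 'rV[R]_m)
    (B : 'M[R]_(m, n)) :
  u @ F --> a -> A @ F --> B -> (fun x => u x *m A x) @ F --> a *m B.
Proof.
move=> ua AB; apply: cvg_row => i; under eq_fun do rewrite mxE; rewrite mxE.
by apply: cvg_sum_ord => j; apply: cvgM; apply: cvg_coord.
Qed.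

Lemma cvg_trmx {T} (F : set_system T) {FF : Filter F} m n
    (A : T -> 'M[R]_(m, n)) (B : 'M[R]_(m, n)) :
  A @ F --> B -> (fun x => (A x)^T) @ F --> B^T.
Proof.
move=> AB; apply: cvg_mx => i j; under eq_fun do rewrite mxE; rewrite mxE.
exact: cvg_coord.
Qed.

Lemma mulmx_norm_le m n (A : 'M[R]_(m, n)) (u : 'rV[R]_m) :
  `|u *m A| <= m%:R * (`|A| * `|u|).
Proof.
apply: row_norm_le => [|i]; first by rewrite !mulr_ge0.
rewrite mxE; apply: le_trans (ler_norm_sum _ _ _) _.
have -> : m%:R * (`|A| * `|u|) = \sum_(j < m) `|A| * `|u|.
  by rewrite sumr_const card_ord mulr_natl.
apply: ler_sum => j _.
rewrite normrM mulrC ler_pM// ?coord_le_norm//.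
by rewrite [leRHS]mx_normrE; apply: (le_trans _ (le_bigmax _ _ (j, i))).
Qed.

End Convergence.

(** * First- and second-order expansions along varying directions *)

Section Differentials.
Context {R : realType}.

Lemma differentiable_norm_le {V W : normedModType R} (F : V -> W) a :
  differentiable F a -> forall e, 0 < e ->
  \forall x \near a, `|F x - F a - 'd F a (x - a)| <= e * `|x - a|.
Proof.
move=> /diff_locally /eqaddoP dF e e0.
rewrite (near_shift 0) subr0; have := dF _ e0; apply: filterS => h.
by rewrite /= !fctE /= !addrK opprD addrA.
Qed.

Lemma near_norm_ltP {V : normedModType R} (a : V) (P : V -> Prop) :
  (\forall x \near a, P x) <-> exists2 r : R, 0 < r & forall x, `|x - a| < r -> P x.
Proof.
split=> [/nbhs_ballP[r r0 aP]|[r r0 aP]].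
  by exists r => // x xr; apply: aP; rewrite -ball_normE /= distrC.
by apply/nbhs_ballP; exists r => // x; rewrite -ball_normE /= distrC; exact: aP.
Qed.

Lemma near_norm_lt {V : normedModType R} (a : V) (r : R) :
  0 < r -> \forall x \near a, `|x - a| < r.
Proof. by move=> r0; apply/near_norm_ltP; exists r. Qed.

Lemma near_norm_lt_open {V : normedModType R} (a p : V) (r : R) :
  `|p - a| < r -> \forall x \near p, `|x - a| < r.
Proof.
move=> pr; apply/near_norm_ltP; exists (r - `|p - a|); first by rewrite subr_gt0.
move=> x; rewrite ltrBrDr; apply: le_lt_trans.
by rewrite -[x - a](subrKA p); exact: ler_normD.
Qed.

Lemma near_fst {T U} (F : set_system T) (G : set_system U) {FG : Filter G}
    (P : T -> Prop) :
  (\forall x \near F, P x) -> \forall p \near filter_prod F G, P p.1.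
Proof. exact: cvg_fst. Qed.

Lemma near_snd {T U} (F : set_system T) (G : set_system U) {FF : Filter F}
    (P : U -> Prop) :
  (\forall x \near G, P x) -> \forall p \near filter_prod F G, P p.2.
Proof. exact: cvg_snd. Qed.

Lemma cvg_step {T} (G : set_system T) {FG : Filter G} :
  (fun p : R * T => p.1) @ filter_prod 0^'+ G --> (0 : R).
Proof.
move=> A A0; have A0' : (0 : R)^'+ A by exact: cvg_within A0.
exact: (@cvg_fst _ _ _ G FG A A0').
Qed.

Lemma cvg_shift_scale {V : normedModType R} (a w : V) :
  (fun p : R * V => a + p.1 *: p.2) @ filter_prod 0^'+ (nbhs w) --> a.
Proof.
rewrite -[X in _ --> X]addr0 -(scale0r w); apply: cvgD; first exact: cvg_cst.
by apply: cvgZ; [exact: cvg_step|exact: cvg_snd].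
Qed.

Lemma cvg_ray {V : normedModType R} (y v : V) :
  (fun t : R => y + t *: v) @ (0 : R)^'+ --> y.
Proof.
rewrite -[X in _ --> X]addr0 -(scale0r v).
by apply: cvgD; [exact: cvg_cst|apply: cvgZ; [exact: cvg_within|exact: cvg_cst]].
Qed.

Lemma near_norm_snd {T} (F : set_system T) {FF : Filter F} {V : normedModType R}
    (w : V) :
  \forall p \near filter_prod F (nbhs w), `|p.2| <= `|w| + 1.
Proof.
apply: (near_snd (P := fun v : V => `|v| <= `|w| + 1)).
have := near_norm_lt w (ltr01 : (0 : R) < 1); apply: filterS => v /ltW vw.
rewrite -[leLHS](subrK `|w|) addrC lerD2l.
exact: le_trans (lerB_dist _ _) vw.
Qed.

(** Stated for an explicit expansion, because this is the form in which the
  gradient of the Lagrangian is controlled around [xbar]. *)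
Lemma cvg_expansion n k (G : 'rV[R]_n -> 'rV[R]_k) (a : 'rV[R]_n)
    (M : 'M[R]_(n, k)) :
  (forall e, 0 < e ->
     \forall x \near a, `|G x - G a - (x - a) *m M| <= e * `|x - a|) ->
  G @ a --> G a.
Proof.
move=> GM; have /near_norm_ltP[r r0 rG] := GM 1 ltr01.
pose K := 1 + n%:R * `|M|; have K0 : 0 < K by rewrite ltr_wpDr ?mulr_ge0.
have nG e : 0 < e -> \forall x \near a, `|G a - G x| < e.
  move=> e0; apply/near_norm_ltP.
  exists (Num.min r (e / K)) => [|x]; first by rewrite lt_min r0 divr_gt0.
  rewrite lt_min ltr_pdivlMr// => /andP[/rG xr xe]; rewrite distrC.
  apply: le_lt_trans xe; rewrite -[G x - G a](subrK ((x - a) *m M)).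
  apply: le_trans (ler_normD _ _) _; rewrite mulrC mulrDl; apply: lerD => //.
  by rewrite -mulrA; exact: mulmx_norm_le.
by apply/(@cvgrPdist_lt _ _ _ (nbhs a)) => e e0; exact: nG.
Qed.

(** A first-order expansion allows the direction to vary with the step. *)
Lemma cvg_first_quotient n k (G : 'rV[R]_n -> 'rV[R]_k) (a w : 'rV[R]_n)
    (M : 'M[R]_(n, k)) :
  (forall e, 0 < e ->
     \forall x \near a, `|G x - G a - (x - a) *m M| <= e * `|x - a|) ->
  (fun p : R * 'rV[R]_n => p.1^-1 *: (G (a + p.1 *: p.2) - G a))
    @ filter_prod 0^'+ (nbhs w) --> w *m M.
Proof.
move=> GM; apply/cvgrPdist_le => /= e e0.
have k0 : 0 < `|w| + 1 by rewrite ltr_wpDl.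
have e1 : 0 < e / 2 / (`|w| + 1) by rewrite !divr_gt0.
have aw : (fun p : R * 'rV[R]_n => a + p.1 *: p.2) @ filter_prod 0^'+ (nbhs w) --> a.
  exact: cvg_shift_scale.
have wM : (fun p : R * 'rV[R]_n => p.2 *m M) @ filter_prod 0^'+ (nbhs w) --> w *m M.
  by apply: cvg_mulmx; [exact: cvg_snd|exact: cvg_cst].
near=> p.
have p1 : 0 < p.1 by near: p; exact: (near_fst (nbhs_right_gt 0)).
have Gp : `|G (a + p.1 *: p.2) - G a - (a + p.1 *: p.2 - a) *m M|
    <= e / 2 / (`|w| + 1) * `|a + p.1 *: p.2 - a|.
  by near: p; exact: (aw _ (GM _ e1)).
have aE : a + p.1 *: p.2 - a = p.1 *: p.2 by rewrite addrAC subrr add0r.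
have -> : w *m M - p.1^-1 *: (G (a + p.1 *: p.2) - G a) =
    (w *m M - p.2 *m M) - p.1^-1 *: (G (a + p.1 *: p.2) - G a -
       (a + p.1 *: p.2 - a) *m M).
  rewrite aE -scalemxAl [in RHS]scalerBr scalerA mulVf ?gt_eqF// scale1r.
  by rewrite opprB addrA subrK.
rewrite (le_trans (ler_normB _ _))// (splitr e) lerD//.
  by near: p; move/cvgrPdist_le: wM; apply; rewrite divr_gt0.
rewrite normrZ normrV ?unitfE ?gt_eqF// gtr0_norm// ler_pdivrMl//.
apply: le_trans Gp _; rewrite aE normrZ (gtr0_norm p1) mulrCA ler_pM2l//.
rewrite mulrAC ler_pdivrMr// ler_wpM2l ?divr_ge0 ?(ltW e0)//.
by near: p; exact: near_norm_snd.
Unshelve. all: by end_near. Qed.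

Lemma is_derive_line {V W : normedModType R} (F : V -> W) a v s d :
  is_derive (a + s *: v) v F d ->
  is_derive s (1 : R) (fun s => F (a + s *: v)) d.
Proof.
have E : (fun h : R => h^-1 *: (((fun s => F (a + s *: v)) \o shift s) (h *: 1)
      - F (a + s *: v)))
    = (fun h => h^-1 *: ((F \o shift (a + s *: v)) (h *: v) - F (a + s *: v))).
  apply/funext => h /=; rewrite [_%:A]mulr1; congr (_ *: (F _ - _)).
  by rewrite scalerDl addrCA.
by case=> dF vF; apply: DeriveDef; rewrite /derivable /derive E.
Qed.

Lemma cvg_right_derive {V W : normedModType R} (F : V -> W) x w d :
  is_derive x w F d ->
  (fun t : R => t^-1 *: (F (x + t *: w) - F x)) @ 0^'+ --> d.
Proof.
case=> /cvg_ex[l Fl] dE; have <- : l = d.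
  by rewrite -dE; apply/esym/cvg_lim.
have -> : (fun t : R => t^-1 *: (F (x + t *: w) - F x)) =
    (fun t => t^-1 *: ((F \o shift x) (t *: w) - F x)).
  by apply/funext => t; rewrite /= [x + _]addrC.
have Q : (fun h : R => h^-1 *: ((F \o shift x) (h *: w) - F x)) @ (0 : R)^'+ `=>`
    (fun h : R => h^-1 *: ((F \o shift x) (h *: w) - F x)) @ (0 : R)^'.
  apply: cvg_app => A A0.
  have A0' : \forall t \near nbhs (0 : R), t != 0 -> A t by exact: A0.
  have : \forall t \near nbhs (0 : R), 0 < t -> A t.
    by apply: filterS A0' => t At t0; apply: At; rewrite gt_eqF.
  exact.
exact: cvg_trans Q Fl.
Qed.

(** The mean value theorem applied to [s |-> l (a + s v) - s^2/2 <v H, v>]. *)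
Lemma second_order_expansion n (l : 'rV[R]_n -> R) (g : 'rV[R]_n -> 'rV[R]_n)
    (a : 'rV[R]_n) (H : 'M[R]_n) :
  (\forall x \near a, forall w, is_derive x w l (dotr (g x) w)) ->
  (forall e, 0 < e ->
     \forall x \near a, `|g x - (x - a) *m H| <= e * `|x - a|) ->
  forall e, 0 < e -> \forall x \near a,
    `|l x - l a - 2^-1 * dotr ((x - a) *m H) (x - a)| <= e * `|x - a| ^+ 2.
Proof.
move=> lD gH e e0.
have e1 : 0 < e / n.+1%:R by rewrite divr_gt0.
have [r /= r0 Hr] : exists2 r : R, 0 < r & forall x, `|x - a| < r ->
   (forall w, is_derive x w l (dotr (g x) w)) /\
   `|g x - (x - a) *m H| <= e / n.+1%:R * `|x - a|.
  by apply/near_norm_ltP; exact: filterI lD (gH _ e1).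
near=> x.
have xr : `|x - a| < r.
  by near: x; exact: (near_norm_lt a r0).
set v := x - a in xr *.
pose q := 2^-1 * dotr (v *m H) v.
pose h s := l (a + s *: v) - q * s ^+ 2.
have hD (s : R) : 0 <= s <= 1 -> is_derive s (1 : R) h
    (dotr (g (a + s *: v)) v - s * dotr (v *m H) v).
  move=> /andP[s0 s1].
  have [|lDs _] := Hr (a + s *: v).
    rewrite [a + _]addrC addrK normrZ ger0_norm//.
    by apply: le_lt_trans xr; rewrite ler_piMl.
  have := is_derive_line (lDs v) => lDs'.
  apply: is_derive_eq; rewrite /q /GRing.scale /=.
  by field.
have [c] : exists2 c, c \in `[0, 1]%R & h 1 - h 0 =
    (dotr (g (a + c *: v)) v - c * dotr (v *m H) v) * (1 - 0).
  apply: MVT_segment => //.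
    by move=> z; rewrite in_itv/= => /andP[z0 z1]; apply: hD; rewrite !ltW.
  apply: derivable_within_continuous => z; rewrite in_itv/= => z01.
  by have [] := hD z z01.
rewrite in_itv/= subr0 mulr1 => /andP[c0 c1] hE.
have -> : l x - l a - q = h 1 - h 0.
  have xE : a + v = x by rewrite /v addrC subrK.
  rewrite /h scale1r scale0r addr0 xE expr1n expr0n/=; ring.
have [|_] := Hr (a + c *: v).
  rewrite [a + _]addrC addrK normrZ ger0_norm//.
  by apply: le_lt_trans xr; rewrite ler_piMl.
rewrite hE [a + _]addrC addrK [c *: v + a]addrC => gc.
rewrite -dotrZl scalemxAl -dotrNl -dotrDl.
apply: le_trans (dotr_norm_le _ _) _.
have cv : `|c *: v| <= `|v| by rewrite normrZ ger0_norm// ler_piMl.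
apply: (@le_trans _ _ (n%:R * (e / n.+1%:R * `|v| * `|v|))).
  rewrite ler_wpM2l// ler_wpM2r//; apply: le_trans gc _.
  by rewrite ler_wpM2l// ltW.
rewrite -[e / _ * _ * _]mulrA -expr2 mulrA ler_wpM2r ?sqr_ge0//.
by rewrite mulrCA ger_pMr// ler_pdivrMr// mul1r ler_nat.
Unshelve. all: by end_near. Qed.

(** A second-order expansion also allows the direction to vary with the step. *)
Lemma cvg_second_quotient n (l : 'rV[R]_n -> R) (a w : 'rV[R]_n) (H : 'M[R]_n) :
  (forall e, 0 < e -> \forall x \near a,
    `|l x - l a - 2^-1 * dotr ((x - a) *m H) (x - a)| <= e * `|x - a| ^+ 2) ->
  (fun p : R * 'rV[R]_n => (p.1 ^+ 2)^-1 * (l (a + p.1 *: p.2) - l a))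
    @ filter_prod 0^'+ (nbhs w) --> 2^-1 * dotr (w *m H) w.
Proof.
move=> lH; apply/cvgrPdist_le => /= e e0.
have k0 : 0 < `|w| + 1 by rewrite ltr_wpDl.
have e1 : 0 < e / 2 / (`|w| + 1) ^+ 2 by rewrite !divr_gt0 ?exprn_gt0.
have aw : (fun p : R * 'rV[R]_n => a + p.1 *: p.2) @ filter_prod 0^'+ (nbhs w) --> a.
  exact: cvg_shift_scale.
have wH : (fun p : R * 'rV[R]_n => 2^-1 * dotr (p.2 *m H) p.2)
    @ filter_prod 0^'+ (nbhs w) --> 2^-1 * dotr (w *m H) w.
  apply: cvgM; first exact: cvg_cst.
  apply: cvg_dotr; last exact: cvg_snd.
  by apply: cvg_mulmx; [exact: cvg_snd|exact: cvg_cst].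
near=> p.
have p1 : 0 < p.1 by near: p; exact: (near_fst (nbhs_right_gt 0)).
have pp : 0 < p.1 ^+ 2 by rewrite exprn_gt0.
have lp : `|l (a + p.1 *: p.2) - l a -
      2^-1 * dotr ((a + p.1 *: p.2 - a) *m H) (a + p.1 *: p.2 - a)|
    <= e / 2 / (`|w| + 1) ^+ 2 * `|a + p.1 *: p.2 - a| ^+ 2.
  by near: p; exact: (aw _ (lH _ e1)).
move: lp; rewrite [a + _ - a]addrAC subrr add0r -scalemxAl dotrZl dotrZr => lp.
have -> : 2^-1 * dotr (w *m H) w - (p.1 ^+ 2)^-1 * (l (a + p.1 *: p.2) - l a) =
    (2^-1 * dotr (w *m H) w - 2^-1 * dotr (p.2 *m H) p.2) -
    (p.1 ^+ 2)^-1 * (l (a + p.1 *: p.2) - l a -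
      2^-1 * (p.1 * (p.1 * dotr (p.2 *m H) p.2))).
  by field; rewrite gt_eqF.
rewrite (le_trans (ler_normB _ _))// (splitr e) lerD//.
  by near: p; move/cvgrPdist_le: wH; apply; rewrite divr_gt0.
rewrite normrM normrV ?unitfE ?gt_eqF// (gtr0_norm pp) ler_pdivrMl//.
apply: le_trans lp _; rewrite normrZ (gtr0_norm p1) exprMn mulrCA ler_pM2l//.
rewrite mulrAC ler_pdivrMr ?exprn_gt0// ler_wpM2l ?divr_ge0 ?(ltW e0)//.
rewrite lerXn2r ?nnegrE ?(ltW k0)//.
by near: p; exact: near_norm_snd.
Unshelve. all: by end_near. Qed.

End Differentials.

(** * Smoothness of the Lagrangian *)

Section Lagrangian.
Context {R : realType} {n m : nat}.
Implicit Types (phi : 'rV[R]_n -> R) (f : 'rV[R]_n -> 'rV[R]_m).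

Lemma dotr_is_linear k (l : 'rV[R]_k) : linear (dotr l : 'rV[R]_k -> R^o).
Proof. by move=> a u v; rewrite dotrDr dotrZr. Qed.

HB.instance Definition _ k (l : 'rV[R]_k) :=
  GRing.isLinear.Build R 'rV[R]_k R^o *:%R (dotr l) (@dotr_is_linear k l).

Lemma dotr_continuous k (l : 'rV[R]_k) :
  continuous (dotr l : 'rV[R]_k -> R^o).
Proof.
move=> u; have lu : (fun=> l) @ nbhs u --> l by exact: cvg_cst.
exact: (@cvg_dotr R _ (nbhs u) _ _ (fun=> l) id l u lu cvg_id).
Qed.

Lemma is_diff_dotr k (l : 'rV[R]_k) (f : 'rV[R]_n -> 'rV[R]_k) x :
  differentiable f x ->
  is_diff x (fun y => dotr l (f y) : R^o) (fun w => dotr l ('d f x w)).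
Proof.
move=> df; have dl y : differentiable (dotr l : 'rV[R]_k -> R^o) y.
  by apply: linear_differentiable; exact: dotr_continuous.
apply: DiffDef; first exact: differentiable_comp.
rewrite (diff_comp df (dl _)) (diff_lin _ (@dotr_continuous k l)).
by [].
Qed.

Lemma diff_gradient phi x w :
  differentiable phi x -> 'd phi x w = dotr (gradient phi x) w.
Proof.
move=> dphi; rewrite [in LHS](row_sum_delta w) linear_sum /dotr.
by apply: eq_bigr => i _; rewrite linearZ/= mxE deriveE// mulrC.
Qed.

Lemma row_expansion k (g : 'rV[R]_n -> 'rV[R]_k) (G : 'I_k -> 'rV[R]_n -> R)
    (M : 'M[R]_(n, k)) a :
  (\forall x \near a, forall j, g x 0 j = G j x) ->
  (forall j, differentiable (G j) a) ->
  (forall i j, M i j = 'd (G j) a (delta_mx 0 i)) ->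
  forall e, 0 < e ->
  \forall x \near a, `|g x - g a - (x - a) *m M| <= e * `|x - a|.
Proof.
move=> gE dG ME e e0.
have : \forall x \near a, forall j,
    `|G j x - G j a - 'd (G j) a (x - a)| <= e * `|x - a|.
  have Gj j : \forall x \near a,
      `|G j x - G j a - 'd (G j) a (x - a)| <= e * `|x - a|.
    exact: (differentiable_norm_le (dG j) e0).
  exact: (@filter_forall _ _ _ (nbhs a) _ Gj).
have gE0 : forall j, g a 0 j = G j a.
  exact: (nbhs_singleton gE).
apply: filterS2 gE => x gEx Gx; apply: row_norm_le => [|j].
  by rewrite mulr_ge0 ?(ltW e0).
have rowB (u v : 'rV[R]_k) : (u - v) 0 j = u 0 j - v 0 j by rewrite !mxE.
apply: le_trans (Gx j); rewrite !rowB gEx gE0.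
rewrite le_eqVlt; apply/orP; left; apply/eqP; congr (`|_ - _|).
rewrite mxE [in RHS](row_sum_delta (x - a)) linear_sum/=.
by apply: eq_bigr => i _; rewrite linearZ/= ME.
Qed.

(** The part of the Lagrangian that depends on [x]. *)
Definition lagrangian phi0 f (l : 'rV[R]_m) x : R := phi0 x + dotr l (f x).

Variables (phi0 : 'rV[R]_n -> R) (f : 'rV[R]_n -> 'rV[R]_m).
Variables (xbar : 'rV[R]_n) (lambda : 'rV[R]_m).
Hypothesis phi0_C2 : C2_around phi0 xbar.
Hypothesis f_C2 : C2_around f xbar.

Local Notation ell := (lagrangian phi0 f lambda).

Lemma lagrangian_is_derive : \forall x \near xbar, forall w,
  is_derive x w ell (dotr (grad_lagrangian phi0 f x lambda) w).
Proof.
apply: filterS2 phi0_C2 f_C2 => x [dphi _ _] [df _ _] w.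
have dl := is_diff_dotr lambda df.
have dell : differentiable (ell : _ -> R^o) x by apply: differentiableD => //; case: dl.
apply: DeriveDef; first exact: diff_derivable.
rewrite deriveE// /lagrangian diffD//.
have -> : 'd (fun y => dotr lambda (f y) : R^o) x = (fun w => dotr lambda ('d f x w)) :> (_ -> _).
  by case: dl.
rewrite /grad_lagrangian dotrDl /= diff_gradient//; congr (_ + _).
by rewrite dotr_mulmx trmxK /jacobian mul_rV_lin1.
Qed.

Lemma jacobian_cvg : (fun x => 'J f x) @ xbar --> 'J f xbar.
Proof.
have JE : \forall x \near xbar, forall i j,
    'J f x i j = ('D_(delta_mx 0 i) f x) 0 j.
  by apply: filterS f_C2 => x [df _ _] i j; rewrite deriveE// /jacobian mxE.
apply: (@cvg_mx _ _ (nbhs xbar)) => i j.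
have JEi : 'J f xbar i j = ('D_(delta_mx 0 i) f xbar) 0 j.
  by have [df _ _] := nbhs_singleton f_C2; rewrite deriveE// /jacobian mxE.
apply: (@eq_ind_r R _ (fun z : R => (fun x => 'J f x i j) @ xbar --> z) _ _ JEi).
have DJ : (fun x => ('D_(delta_mx 0 i) f x) 0 j) @ xbar -->
    ('D_(delta_mx 0 i) f xbar) 0 j.
  apply: (@cvg_coord _ _ (nbhs xbar)); have [_ /(_ (delta_mx 0 i)) df _] := nbhs_singleton f_C2.
  exact: (differentiable_continuous df).
have DE : {near nbhs xbar, (fun x => ('D_(delta_mx 0 i) f x) 0 j) =1
    (fun x => 'J f x i j)} by apply: filterS JE => x ->.
exact: (cvg_trans (near_eq_cvg DE) DJ).
Qed.

(** The j-th coordinate of the gradient agrees near [xbar] with the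
  differentiable function [x |-> D_j phi0 x + <lambda, D_j f x>], whose partial
  derivatives are the j-th column of the Hessian matrix. *)
Lemma grad_lagrangian_expansion e : 0 < e -> \forall x \near xbar,
  `|grad_lagrangian phi0 f x lambda - grad_lagrangian phi0 f xbar lambda
     - (x - xbar) *m hess_lagrangian phi0 f xbar lambda| <= e * `|x - xbar|.
Proof.
move=> e0.
pose G (j : 'I_n) x : R :=
  'D_(delta_mx 0 j) phi0 x + dotr lambda ('D_(delta_mx 0 j) f x).
have gE : \forall x \near xbar, forall j,
    grad_lagrangian phi0 f x lambda 0 j = G j x.
  apply: filterS f_C2 => x [df _ _] j; rewrite /grad_lagrangian mxE mxE.
  congr (_ + _); rewrite mxE; apply: eq_bigr => k _.
  by rewrite deriveE// /jacobian !mxE.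
have [_ /(_ _) dphi _] := nbhs_singleton phi0_C2.
have [_ /(_ _) df _] := nbhs_singleton f_C2.
have dl j := is_diff_dotr lambda (df (delta_mx 0 j)).
have dG j : differentiable (G j) xbar.
  by apply: differentiableD => //; case: (dl j).
have HE i j : hess_lagrangian phi0 f xbar lambda i j = 'd (G j) xbar (delta_mx 0 i).
  rewrite /hess_lagrangian !mxE diffD//.
  rewrite /= deriveE//; congr (_ + _); rewrite -deriveE; last by case: (dl j).
  apply: near_eq_derive; apply: filterS f_C2 => x [dfx _ _].
  have dlx := is_diff_dotr lambda dfx.
  rewrite deriveE; last by case: dlx.
  have -> : 'd (fun y => dotr lambda (f y) : R^o) x =
      (fun w => dotr lambda ('d f x w)) :> (_ -> _) by case: dlx.
  by rewrite deriveE.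
exact: (row_expansion gE dG HE e0).
Qed.

End Lagrangian.

(** * Lower limits and the second subderivative of a convex function *)

Section LowerLimits.
Context {R : realType} {T : choiceType} {X : filteredType T}.
Implicit Types (F : set_system X) (h : X -> \bar R).

Lemma limf_einf_gt F (FF : Filter F) h a :
  (a < limf_einf h F)%E -> \forall p \near F, (a < h p)%E.
Proof.
rewrite limf_einfE => /ereal_sup_gtP[_ [V FV <-] aV].
apply: filterS FV => p Vp; apply: lt_le_trans aV _.
by apply: ge_ereal_inf; exists (h p) => //; exists p.
Qed.

Lemma limf_einf_ge F h a :
  (\forall p \near F, (a <= h p)%E) -> (a <= limf_einf h F)%E.
Proof.
move=> ah; rewrite limf_einfE.
apply: (@le_trans _ _ (ereal_inf (h @` [set p | (a <= h p)%E]))).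
  by apply: le_ereal_inf_tmp => _ [p /= ap <-].
by apply: ereal_sup_ubound; exists [set p | (a <= h p)%E].
Qed.

Lemma limf_einf_le F h a :
  (forall V, F V -> exists2 p, V p & (h p <= a)%E) -> (limf_einf h F <= a)%E.
Proof.
move=> ha; rewrite limf_einfE; apply: ge_ereal_sup => _ [V /ha[p Vp hp] <-].
by apply: ge_ereal_inf; exists (h p) => //; exists p.
Qed.

End LowerLimits.

Lemma lt_EFin_between (R : realType) (x : R) (y : \bar R) : (x%:E < y)%E ->
  exists2 a, x < a & (a%:E < y)%E.
Proof.
case: y => [y| |//].
  by rewrite lte_fin => xy; exists (2^-1 * (x + y)); rewrite ?lte_fin; lra.
by move=> _; exists (x + 1); rewrite ?ltry// ltrDl.
Qed.

Section Filters.
Context {R : realType}.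

Lemma within_proper {T} (F : set_system T) {FF : Filter F} (D : set T) :
  ~ F (~` D) -> ProperFilter (within D F).
Proof.
move=> FD; apply: Build_ProperFilter_ex => // P DP.
apply: contrapT => nP; apply: FD.
have DP' : F [set x | D x -> P x] by exact: DP.
apply: filterS DP' => x DPx Dx.
by apply: nP; exists x; exact: DPx.
Qed.

Lemma le_cvg {T} (F : set_system T) {FF : ProperFilter F} (f g : T -> R) a b :
  f @ F --> a -> g @ F --> b -> (\forall x \near F, f x <= g x) -> a <= b.
Proof.
move=> fa gb fg; rewrite leNgt; apply/negP => ba.
have [x [[fx gx] fgx]] : exists x, (2^-1 * (a + b) < f x /\
    g x < 2^-1 * (a + b)) /\ f x <= g x.
  apply: (@filter_ex _ F); near=> x; split; last by near: x.
  split; near: x.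
    by apply: (cvgr_gt a) => //; lra.
  by apply: (cvgr_lt b) => //; lra.
by move: (le_lt_trans fgx gx); rewrite ltNge (ltW fx).
Unshelve. all: by end_near. Qed.

(** Along a proper filter, one of finitely many alternatives occurs
  frequently; [within] then replaces the extraction of a subsequence. *)
Lemma pigeonhole_filter {T} (F : set_system T) {FF : ProperFilter F} s
    (Q : 'I_s -> set T) :
  (\forall x \near F, exists i, Q i x) -> exists i, ProperFilter (within (Q i) F).
Proof.
move=> FQ; apply: contrapT => /forallNP nQ.
have nF i : F (~` Q i).
  by apply: contrapT => nFi; apply: (nQ i); exact: within_proper.
have : F set0; last exact: filter_not_empty.
have nFF : \forall x \near F, forall i, ~ Q i x by exact: filter_forall.
by apply: filterS (filterI FQ nFF) => x [[i Qix] /(_ i)].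
Qed.

Lemma le0_affine_near (c q : R) :
  (\forall t \near 0^'+, 0 <= c + t * q) -> 0 <= c.
Proof.
have lF : (fun t => c + t * q) @ (0 : R)^'+ --> c + 0 * q.
  apply: cvgD; first exact: cvg_cst.
  by apply: cvgM; [exact: cvg_within|exact: cvg_cst].
by rewrite mul0r addr0 in lF; apply: (le_cvg (cvg_cst 0) lF).
Qed.

Lemma le0_affine (c q : R) : (forall t, 0 < t < 1 -> 0 <= c + t * q) -> 0 <= c.
Proof.
move=> cq; apply: (@le0_affine_near _ q); near=> t; apply: cq.
by apply/andP; split.
Unshelve. all: by end_near. Qed.

End Filters.

Section Gap.
Context {R : realType} {m : nat}.
Variables (theta : 'rV[R]_m -> \bar R) (ybar lb : 'rV[R]_m).

(** The excess of [theta] over its affine minorant of slope [lb] at [ybar],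
  as a real number; it is only meaningful on the domain of [theta]. *)
Definition gap y : R := fine (theta y) - fine (theta ybar) - dotr lb (y - ybar).

Let addKB (v w : 'rV[R]_m) : v + w - v = w.
Proof. by rewrite addrAC subrr add0r. Qed.

Lemma gap_base : gap ybar = 0.
Proof. by rewrite /gap !subrr dotr0r subrr. Qed.

Hypothesis theta_gtNy : forall y, (-oo < theta y)%E.
Hypothesis theta_convex : econvex theta.
Hypothesis lb_sub : subdifferential theta ybar lb.

Let ybar_dom : edom theta ybar := lb_sub.1.

Lemma fine_theta y : edom theta y -> theta y = (fine (theta y))%:E.
Proof. by move=> y_dom; rewrite fineK// fin_real// theta_gtNy. Qed.

Lemma not_edom y : ~ edom theta y -> theta y = +oo%E.
Proof. by rewrite /edom /= => /negP; rewrite ltey negbK => /eqP. Qed.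

Lemma subdifferentialP y l : subdifferential theta y l <->
  edom theta y /\
  forall z, edom theta z -> gap y + dotr (l - lb) (z - y) <= gap z.
Proof.
have gapE z : edom theta z -> (theta y + (dotr l (z - y))%:E <= theta z)%E =
    (gap y + dotr (l - lb) (z - y) <= gap z) :> bool \/ ~ edom theta y.
  move=> z_dom; have [y_dom|] := pselect (edom theta y); [left|by right].
  rewrite (fine_theta y_dom) (fine_theta z_dom) -EFinD lee_fin.
  rewrite /gap !dotr_lin; apply/idP/idP; lra.
split=> -[y_dom yl]; split=> // z.
  by move=> z_dom; have [<-|//] := gapE z z_dom; exact: yl.
have [z_dom|/not_edom->] := pselect (edom theta z); last by rewrite leey.
by have [->|//] := gapE z z_dom; exact: yl.
Qed.

Lemma gap_ge0 y : edom theta y -> 0 <= gap y.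
Proof.
move=> y_dom; have /subdifferentialP[_ /(_ _ y_dom)] := lb_sub.
by rewrite gap_base subrr dotr0l addr0.
Qed.

Lemma gap_convex y z t : edom theta y -> edom theta z -> 0 < t < 1 ->
  edom theta (t *: y + (1 - t) *: z) /\
  gap (t *: y + (1 - t) *: z) <= t * gap y + (1 - t) * gap z.
Proof.
move=> y_dom z_dom t01; have := theta_convex y z t01.
rewrite [in leRHS](fine_theta y_dom) [in leRHS](fine_theta z_dom).
rewrite -!EFinM -EFinD => tle.
have t_dom : edom theta (t *: y + (1 - t) *: z).
  by apply: le_lt_trans tle _; rewrite ltry.
split=> //; move: tle; rewrite (fine_theta t_dom) lee_fin /gap !dotr_lin; lra.
Qed.

Lemma gap_segment y t : edom theta y -> 0 < t < 1 ->
  edom theta (ybar + t *: (y - ybar)) /\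
  gap (ybar + t *: (y - ybar)) <= t * gap y.
Proof.
move=> y_dom t01; have [] := gap_convex y_dom ybar_dom t01.
rewrite gap_base mulr0 addr0.
suff -> : t *: y + (1 - t) *: ybar = ybar + t *: (y - ybar) by [].
by rewrite scalerBl scale1r scalerBr addrCA.
Qed.

Lemma second_quotient t w : 0 < t ->
  ((2^-1 * t ^+ 2)^-1%:E *
     (theta (ybar + t *: w)%R - theta ybar - (t * dotr lb w)%:E))%E =
  if pselect (edom theta (ybar + t *: w)) then
    ((2^-1 * t ^+ 2)^-1 * gap (ybar + t *: w))%:E else +oo%E.
Proof.
move=> t0; have t2 : 0 < (2^-1 * t ^+ 2)^-1.
  by rewrite invr_gt0 mulr_gt0 ?invr_gt0// exprn_gt0.
rewrite (fine_theta ybar_dom); case: pselect => [t_dom|t_dom]; last first.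
  by rewrite (not_edom t_dom) /= gt0_muley.
rewrite (fine_theta t_dom) -!EFinB -EFinM; congr (_ * _)%:E.
by rewrite /gap addKB dotrZr.
Qed.

Lemma second_subderivative_gt w (a : R) :
  (a%:E < second_subderivative theta ybar lb w)%E ->
  \forall p \near filter_prod 0^'+ (nbhs w), edom theta (ybar + p.1 *: p.2) ->
    2^-1 * p.1 ^+ 2 * a < gap (ybar + p.1 *: p.2).
Proof.
move=> /limf_einf_gt aD; near=> p => p_dom.
have p1 : 0 < p.1 by near: p; exact: (near_fst (nbhs_right_gt 0)).
have : (a%:E < (2^-1 * p.1 ^+ 2)^-1%:E *
    (theta (ybar + p.1 *: p.2)%R - theta ybar - (p.1 * dotr lb p.2)%:E))%E.
  by near: p; exact: aD.
rewrite second_quotient//; case: pselect => //= _.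
by rewrite lte_fin mulrC ltr_pdivlMr ?mulr_gt0 ?exprn_gt0// mulrC.
Unshelve. all: by end_near. Qed.

Lemma second_subderivative_le w (a : R) :
  (forall V, filter_prod 0^'+ (nbhs w) V -> exists p : R * 'rV[R]_m,
     [/\ V p, 0 < p.1, edom theta (ybar + p.1 *: p.2) &
         gap (ybar + p.1 *: p.2) <= 2^-1 * p.1 ^+ 2 * a]) ->
  (second_subderivative theta ybar lb w <= a%:E)%E.
Proof.
move=> aV; apply: limf_einf_le => V FV; have [p [Vp p1 p_dom pa]] := aV V FV.
exists p => //.
rewrite second_quotient//; case: pselect => //= _.
by rewrite lee_fin mulrC ler_pdivrMr ?mulr_gt0 ?exprn_gt0// mulrC.
Qed.

Lemma second_subderivative_frequently w (a e : R) V : 0 < e ->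
  (second_subderivative theta ybar lb w <= a%:E)%E ->
  filter_prod 0^'+ (nbhs w) V -> exists p : R * 'rV[R]_m,
    [/\ V p, 0 < p.1, edom theta (ybar + p.1 *: p.2) &
         gap (ybar + p.1 *: p.2) <= 2^-1 * p.1 ^+ 2 * (a + e)].
Proof.
move=> e0 Da FV; apply: contrapT => nV.
have : ((a + e)%:E <= second_subderivative theta ybar lb w)%E.
  apply: limf_einf_ge; near=> p.
  have p1 : 0 < p.1 by near: p; exact: (near_fst (nbhs_right_gt 0)).
  have Vp : V p by near: p.
  rewrite second_quotient//; case: pselect => /= [p_dom|_]; last by rewrite leey.
  rewrite lee_fin leNgt; apply/negP => pa; apply: nV; exists p; split=> //.
  by rewrite -ler_pdivrMl ?mulr_gt0 ?exprn_gt0// ltW.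
by move=> /le_trans/(_ Da); rewrite lee_fin; lra.
Unshelve. all: by end_near. Qed.

(** A finite second subderivative at [w] forces first-order growth along [w]
  to be exactly that of the affine minorant. *)
Lemma second_subderivative_critical w (a : R) :
  (second_subderivative theta ybar lb w <= a%:E)%E ->
  critical_cone theta ybar lb w.
Proof.
move=> Da; rewrite /critical_cone /= /subderivative.
have quot t v : 0 < t -> edom theta (ybar + t *: v) ->
    (t^-1%:E * (theta (ybar + t *: v)%R - theta ybar))%E =
    (t^-1 * gap (ybar + t *: v) + dotr lb v)%:E.
  move=> t0 t_dom; rewrite (fine_theta ybar_dom) (fine_theta t_dom).
  rewrite -EFinB -EFinM /gap addKB dotrZr; congr _%:E.
  by field; rewrite gt_eqF.
have lbw : (fun p : R * 'rV[R]_m => dotr lb p.2) @ filter_prod 0^'+ (nbhs w)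
    --> dotr lb w.
  by apply: cvg_dotr; [exact: cvg_cst|exact: cvg_snd].
apply/le_anti/andP; split; apply/lee_addgt0Pr => /= e e0.
  apply: limf_einf_le => V FV.
  pose F := filter_prod (0 : R)^'+ (nbhs w).
  have c0 : 0 < `|a| + 1 by rewrite ltr_wpDl.
  have FW : F (V `&` [set p | dotr lb p.2 <= dotr lb w + e / 2 /\
                              2^-1 * p.1 * (`|a| + 1) <= e / 2]).
    apply: filterI => //; near=> p; split.
      rewrite -lerBlDl (le_trans (ler_norm _))// distrC.
      by near: p; move/cvgrPdist_le: lbw; apply; rewrite divr_gt0.
    have : p.1 <= e / (`|a| + 1).
      near: p; apply: (near_fst (P := fun t => t <= e / (`|a| + 1))).
      by apply: nbhs_right_le; rewrite divr_gt0.
    by rewrite ler_pdivlMr//; lra.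
  have [p [[Vp [p2 p1e]] p1 p_dom pa]] := second_subderivative_frequently ltr01 Da FW.
  exists p => //; rewrite quot// -EFinD lee_fin addrC.
  have : p.1^-1 * gap (ybar + p.1 *: p.2) <= 2^-1 * p.1 * (`|a| + 1).
    rewrite ler_pdivrMl//; apply: le_trans pa _.
    have : a <= `|a| by exact: ler_norm.
    have : 0 < p.1 ^+ 2 by rewrite exprn_gt0.
    by rewrite expr2; nra.
  lra.
rewrite -leeBlDr//; apply: limf_einf_ge; near=> p.
have p1 : 0 < p.1 by near: p; exact: (near_fst (nbhs_right_gt 0)).
have [p_dom|p_dom] := pselect (edom theta (ybar + p.1 *: p.2)); last first.
  rewrite (not_edom p_dom) (fine_theta ybar_dom) /= gt0_muley ?leey//.
  by rewrite lte_fin invr_gt0.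
rewrite quot// -EFinB lee_fin.
have : 0 <= p.1^-1 * gap (ybar + p.1 *: p.2).
  by rewrite mulr_ge0 ?gap_ge0// invr_ge0 ltW.
suff : dotr lb w - e <= dotr lb p.2 by lra.
rewrite lerBlDl -lerBlDr (le_trans (ler_norm _))//.
by near: p; move/cvgrPdist_le: lbw; apply.
Unshelve. all: by end_near. Qed.

End Gap.

(** * Polyhedral sets *)

Section Polyhedral.
Context {R : realType} {m : nat}.
Implicit Types (Omega : set 'rV[R]_m) (y d : 'rV[R]_m).

Lemma near_ray (b y d : 'rV[R]_m) (beta : R) :
  dotr b y <= beta -> (dotr b y = beta -> dotr b d <= 0) ->
  \forall t \near 0^'+, dotr b (y + t *: d) <= beta.
Proof.
rewrite le_eqVlt => /orP[/eqP yb /(_ yb) db|yb _]; near=> t.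
  have t0 : 0 < t by [].
  by rewrite dotrDr dotrZr yb gerDl pmulr_rle0.
rewrite dotrDr dotrZr.
have t0 : 0 < t by [].
have d0 : 0 < `|dotr b d| + 1 by rewrite ltr_wpDl.
have : t <= (beta - dotr b y) / (`|dotr b d| + 1).
  by near: t; apply: nbhs_right_le; rewrite divr_gt0// subr_gt0.
rewrite ler_pdivlMr// => tb.
have : dotr b d <= `|dotr b d| by exact: ler_norm.
nra.
Unshelve. all: by end_near. Qed.

Lemma polyhedral_closed Omega y : polyhedral Omega -> ~ Omega y ->
  \forall y' \near y, ~ Omega y'.
Proof.
move=> [k [b [beta ->]]] /= /existsNP[i /negP]; rewrite -ltNge => yi.
have : (dotr (b i) : 'rV[R]_m -> R^o) @ nbhs y --> dotr (b i) y by exact: dotr_continuous.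
move=> /cvgr_gt/(_ _ yi); apply: filterS => y' y'i /(_ i).
by rewrite leNgt y'i.
Qed.

Lemma polyhedral_segment Omega y v t : polyhedral Omega ->
  Omega y -> Omega (y + v) -> 0 <= t <= 1 -> Omega (y + t *: v).
Proof.
move=> [k [b [beta ->]]] /= yO vO /andP[t0 t1] i.
by have := yO i; have := vO i; rewrite !dotr_lin; nra.
Qed.

(** A limit of feasible directions of a polyhedron is a feasible direction:
  it satisfies the constraints active at the base point, and the other
  constraints are slack there. *)
Lemma polyhedral_tangent Omega y d {I} (F : set_system I) {FF : ProperFilter F}
    (t : I -> R) (v : I -> 'rV[R]_m) :
  polyhedral Omega -> (\forall i \near F, 0 < t i) ->
  t @ F --> 0 -> v @ F --> d -> (\forall i \near F, Omega (y + t i *: v i)) ->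
  Omega y /\ \forall s \near 0^'+, Omega (y + s *: d).
Proof.
move=> [k [b [beta ->]]] t0 tF vF OF.
have OFj j : \forall i \near F, dotr (b j) (y + t i *: v i) <= beta j.
  by apply: filterS OF => i /(_ j).
have yb j : dotr (b j) y <= beta j.
  have : (fun i => dotr (b j) (y + t i *: v i)) @ F --> dotr (b j) (y + 0 *: d).
    by apply: cvg_dotr; [exact: cvg_cst|apply: cvgD; [exact: cvg_cst|exact: cvgZ]].
  rewrite scale0r addr0 => yF.
  have bF : (fun=> beta j) @ F --> beta j by exact: cvg_cst.
  exact: (le_cvg yF bF (OFj j)).
split=> //; apply: filter_forall => j; apply: near_ray => // ybE.
have dF : (fun i => dotr (b j) (v i)) @ F --> dotr (b j) d.
  by apply: cvg_dotr => //; exact: cvg_cst.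
have bF : (fun=> 0 : R) @ F --> (0 : R) by exact: cvg_cst.
have le0 : \forall i \near F, dotr (b j) (v i) <= 0.
  apply: filterS2 t0 (OFj j) => i ti.
  by rewrite dotrDr dotrZr ybE gerDl pmulr_rle0.
exact: (le_cvg dF bF le0).
Qed.

(** Farkas' lemma for a cone of feasible directions: where the form [c] is
  nonpositive so is [mu], hence [mu] is dominated by a multiple of [c]. *)
Lemma polyhedral_farkas Omega y (c mu : 'rV[R]_m) : polyhedral Omega -> Omega y ->
  (forall v, (\forall t \near 0^'+, Omega (y + t *: v)) ->
     dotr c v <= 0 -> dotr mu v <= 0) ->
  exists2 gam : R, 0 <= gam & forall v,
    (\forall t \near 0^'+, Omega (y + t *: v)) -> dotr mu v <= gam * dotr c v.
Proof.
move=> [k [b [beta ->]]] /= yO cmu.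
pose act i := dotr (b i) y == beta i.
pose a (i : 'I_k.+1) : 'rV[R]_m :=
  if unlift ord_max i is Some j then (if act j then - b j else 0) else - c.
have aj (j : 'I_k) : a (lift ord_max j) = if act j then - b j else 0.
  by rewrite /a liftK.
have ac : a ord_max = - c by rewrite /a unlift_none.
have [w aw|g g0 muE] := @farkas R m _ a (- mu).
  rewrite dotrNl oppr_ge0; apply: cmu; last first.
    by have := aw ord_max; rewrite ac dotrNl oppr_ge0.
  apply: filter_forall => j; apply: near_ray => // yj.
  by have := aw (lift ord_max j); rewrite aj /act yj eqxx dotrNl oppr_ge0.
exists (g ord_max); first exact: g0.
move=> v vO.
have bv j : act j -> dotr (b j) v <= 0.
  move=> /eqP yj; near (0 : R)^'+ => t.
  have t0 : 0 < t by [].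
  have : dotr (b j) (y + t *: v) <= beta j by near: t; apply: filterS vO => t /(_ j).
  by rewrite dotrDr dotrZr yj gerDl pmulr_rle0.
have : dotr v (- mu) = \sum_i g i * dotr v (a i).
  by rewrite muE dotr_sumr; apply: eq_bigr => i _; rewrite dotrZr.
rewrite (bigD1_ord ord_max)//= ac !dotrNr mulrN dotrC => /eqP.
rewrite eqr_oppLR opprD opprK => /eqP ->.
rewrite [dotr v c]dotrC gerDl oppr_le0; apply: sumr_ge0 => j _.
rewrite mulr_ge0// aj; case: ifPn => [actj|_]; last by rewrite dotr0r.
by rewrite dotrNr oppr_ge0 dotrC bv.
Unshelve. all: by end_near. Qed.

End Polyhedral.

(** * Piecewise linear-quadratic functions *)

Section PiecewiseLinearQuadratic.
Context {R : realType} {m : nat}.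
Variables (theta : 'rV[R]_m -> \bar R) (ybar lb : 'rV[R]_m).
Hypothesis theta_gtNy : forall y, (-oo < theta y)%E.
Hypothesis theta_convex : econvex theta.
Hypothesis lb_sub : subdifferential theta ybar lb.

Local Notation gapb := (gap theta ybar lb).
Let ybar_dom : edom theta ybar := lb_sub.1.

Section Pieces.
Variables (s : nat) (Omega : 'I_s -> set 'rV[R]_m) (A : 'I_s -> 'M[R]_m).
Variables (a : 'I_s -> 'rV[R]_m) (alpha : 'I_s -> R).
Hypothesis Omega_poly : forall i, polyhedral (Omega i).
Hypothesis A_sym : forall i, (A i)^T = A i.
Hypothesis theta_dom : edom theta = \bigcup_i Omega i.
Hypothesis thetaE : forall i y, Omega i y ->
  theta y = (2^-1 * dotr (y *m A i) y + dotr (a i) y + alpha i)%:E.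

Lemma piece_dom i y : Omega i y -> edom theta y.
Proof. by rewrite theta_dom => Oy; exists i. Qed.

Lemma dom_piece y : edom theta y -> exists i, Omega i y.
Proof. by rewrite theta_dom => -[i _ Oy]; exists i. Qed.

(** The slope at [ybar] of the gap along piece [i]. *)
Let c i : 'rV[R]_m := ybar *m A i + a i - lb.

Lemma gap_piece i v t : Omega i ybar -> Omega i (ybar + t *: v) ->
  gapb (ybar + t *: v) = t * dotr (c i) v + 2^-1 * t ^+ 2 * dotr (v *m A i) v.
Proof.
move=> Oy Ov; rewrite /gap (thetaE Oy) (thetaE Ov) /=.
have sym : dotr (v *m A i) ybar = dotr (ybar *m A i) v.
  by rewrite dotr_mulmx A_sym dotrC.
rewrite [ybar + _ - ybar]addrAC subrr add0r mulmxDl -scalemxAl /c !dotr_lin sym.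
by field.
Qed.

Lemma slope_ge0 i v : Omega i ybar -> Omega i (ybar + v) -> 0 <= dotr (c i) v.
Proof.
move=> Oy Ov; apply: (@le0_affine _ _ (2^-1 * dotr (v *m A i) v)) => t t01.
have /andP[t0 t1] := t01.
have Ot : Omega i (ybar + t *: v).
  by apply: polyhedral_segment => //; rewrite !ltW.
have := gap_ge0 theta_gtNy lb_sub (piece_dom Ot).
rewrite (gap_piece Oy Ot) expr2.
have -> : t * dotr (c i) v + 2^-1 * (t * t) * dotr (v *m A i) v =
    t * (dotr (c i) v + t * (2^-1 * dotr (v *m A i) v)) by ring.
by rewrite pmulr_rge0.
Qed.

Lemma gap_lsc_pieces y r : (edom theta y -> r < gapb y) ->
  \forall y' \near y, edom theta y' -> r < gapb y'.
Proof.
move=> ry.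
have : \forall y' \near y, forall i, Omega i y' -> r < gapb y'.
  apply: (@filter_forall _ _ _ (nbhs y)) => i.
  have [Oy|nOy] := pselect (Omega i y); last first.
    by apply: filterS (polyhedral_closed (Omega_poly i) nOy) => y' nOy' /nOy'.
  pose h y' := 2^-1 * dotr (y' *m A i) y' + dotr (a i) y' + alpha i
               - fine (theta ybar) - dotr lb (y' - ybar).
  have hE y' : Omega i y' -> gapb y' = h y'.
    by move=> Oy'; rewrite /gap (thetaE Oy').
  have hcvg : h @ nbhs y --> h y.
    have idy : id @ nbhs y --> y by exact: cvg_id.
    have cy k (z : 'rV[R]_k) : (fun=> z) @ nbhs y --> z by exact: cvg_cst.
    apply: cvgB; [apply: cvgB; [apply: cvgD; [apply: cvgD|]|]|].
    - apply: cvgM; first exact: cvg_cst.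
      apply: cvg_dotr => //; apply: cvg_mulmx => //; exact: cvg_cst.
    - exact: (cvg_dotr (cy _ (a i)) idy).
    - exact: cvg_cst.
    - exact: cvg_cst.
    - have dy : (fun y' => y' - ybar) @ nbhs y --> y - ybar.
        by apply: cvgB; [exact: cvg_id|exact: cvg_cst].
      exact: (cvg_dotr (cy _ lb) dy).
  have rh : r < h y by rewrite -hE//; apply: ry; exact: piece_dom Oy.
  have hr : \forall y' \near y, r < h y' by exact: (cvgr_gt _ hcvg _ rh).
  by apply: filterS hr => y' rh' Oy'; rewrite hE.
by apply: filterS => y' Hy' /dom_piece[i /Hy'].
Qed.

Section Derivative.
Variables (d mu : 'rV[R]_m).
Hypothesis dmu :
  graphical_derivative (subdifferential theta) ybar lb d mu.

(** Along a sequence realizing [mu] as a derivative of the subdifferential in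
  direction [d], one of the finitely many pieces is visited infinitely often;
  [F] selects these indices. *)
Lemma derivative_piece : exists i (F : set_system nat) (t : nat -> R)
    (y mu_ : nat -> 'rV[R]_m),
  [/\ ProperFilter F, forall k, 0 < t k & t @ F --> 0] /\
  [/\ y @ F --> d, mu_ @ F --> mu,
      \forall k \near F, Omega i (ybar + t k *: y k) &
      forall k z, edom theta z ->
        gapb (ybar + t k *: y k) + t k * dotr (mu_ k) (z - (ybar + t k *: y k))
          <= gapb z].
Proof.
have [t [w [t0 tc wc sub]]] := dmu.
have subk k : subdifferential theta (ybar + t k *: (w k).1) (lb + t k *: (w k).2).
  exact: sub k.
have : \forall k \near \oo, exists i, Omega i (ybar + t k *: (w k).1).
  by near=> k; apply: dom_piece; exact: (subk k).1.
move=> /pigeonhole_filter[i iF].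
exists i, (within [set k | Omega i (ybar + t k *: (w k).1)] \oo), t,
  (fun k => (w k).1), (fun k => (w k).2).
have wF T (g : nat -> T) (G : set_system T) : g @ \oo --> G ->
    g @ within [set k | Omega i (ybar + t k *: (w k).1)] \oo --> G.
  by move=> gG; apply: cvg_trans gG; apply: cvg_app; exact: cvg_within.
split; first by split=> //; exact: wF.
split.
- by apply: wF; apply: (cvg_comp _ _ wc); exact: cvg_fst.
- by apply: wF; apply: (cvg_comp _ _ wc); exact: cvg_snd.
- exact: withinT.
- move=> k z z_dom; have /(subdifferentialP ybar lb theta_gtNy)[_ /(_ z z_dom)] := subk k.
  by rewrite [lb + _ - lb]addrAC subrr add0r dotrZl.
Unshelve. all: by end_near. Qed.

(** The subgradient inequality at [z = ybar] shows that the slope of the piece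
  vanishes along [d]. At [z = ybar + t_k sigma v], with [v] feasible for a piece
  [j] of zero slope along [v], it reads
  [sigma^2/2 <v A_j, v> >= <c_i, y_k>/t_k + <y_k A_i, y_k>/2
  + <mu_k, sigma v - y_k>] once divided by [t_k^2], and the first term on the
  right is nonnegative. *)
Lemma derivative_second_order : exists i,
  [/\ Omega i ybar, \forall s \near 0^'+, Omega i (ybar + s *: d),
      dotr (c i) d = 0 &
      forall j v sigma, 0 < sigma -> Omega j ybar ->
        (\forall s \near 0^'+, Omega j (ybar + s *: v)) -> dotr (c j) v = 0 ->
        2^-1 * dotr (d *m A i) d + dotr mu (sigma *: v - d)
          <= 2^-1 * sigma ^+ 2 * dotr (v *m A j) v].
Proof.
have [i [F [t [y [mu_ [[FF t0 tF] [yF muF yO sub]]]]]]] := derivative_piece.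
have [Oy dO] := polyhedral_tangent (Omega_poly i) (filterE _ t0) tF yF yO.
have cyF : (fun k => dotr (c i) (y k)) @ F --> dotr (c i) d.
  by apply: cvg_dotr => //; exact: cvg_cst.
have qF : (fun k => dotr (y k *m A i) (y k)) @ F --> dotr (d *m A i) d.
  by apply: cvg_dotr => //; apply: cvg_mulmx => //; exact: cvg_cst.
have cy0 : \forall k \near F, 0 <= dotr (c i) (y k).
  apply: filterS yO => k yk; have := slope_ge0 Oy yk.
  by rewrite dotrZr pmulr_rge0.
have cd : dotr (c i) d = 0.
  apply/le_anti/andP; split; last first.
    by apply: le_cvg (cvg_cst 0) cyF cy0.
  have ub : (fun k => t k * (dotr (mu_ k) (y k) - 2^-1 * dotr (y k *m A i) (y k)))
      @ F --> 0 * (dotr mu d - 2^-1 * dotr (d *m A i) d).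
    apply: cvgM => //; apply: cvgB; first exact: cvg_dotr.
    by apply: cvgM => //; exact: cvg_cst.
  rewrite mul0r in ub; apply: le_cvg cyF ub _; apply: filterS yO => k yk.
  have := sub k ybar ybar_dom; rewrite gap_base (gap_piece Oy yk).
  have tk := t0 k; rewrite !dotr_lin -subr_ge0 => H.
  rewrite -subr_ge0 -(pmulr_rge0 _ tk); apply: le_trans H _.
  by rewrite le_eqVlt; apply/orP; left; apply/eqP; ring.
exists i; split=> // j v sigma sigma0 Ojy vO cv.
have lF : (fun k => 2^-1 * dotr (y k *m A i) (y k) +
      dotr (mu_ k) (sigma *: v - y k)) @ F -->
    2^-1 * dotr (d *m A i) d + dotr mu (sigma *: v - d).
  apply: cvgD; first by apply: cvgM => //; exact: cvg_cst.
  by apply: cvg_dotr => //; apply: cvgB => //; exact: cvg_cst.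
apply: le_cvg lF (cvg_cst (2^-1 * sigma ^+ 2 * dotr (v *m A j) v)) _.
have vOF : \forall k \near F, Omega j (ybar + (t k * sigma) *: v).
  have tsF : (fun k => t k * sigma) @ F --> 0 * sigma.
    by apply: cvgM => //; exact: cvg_cst.
  rewrite mul0r in tsF.
  have vO' : \forall k \near F, 0 < t k * sigma -> Omega j (ybar + (t k * sigma) *: v).
    exact: (tsF _ vO).
  by apply: filterS vO' => k; apply; rewrite mulr_gt0.
near=> k.
have yk : Omega i (ybar + t k *: y k) by near: k.
have vk : Omega j (ybar + (t k * sigma) *: v) by near: k.
have ck : 0 <= dotr (c i) (y k) by near: k.
have := sub k _ (piece_dom vk).
rewrite (gap_piece Oy yk) (gap_piece Ojy vk) cv mulr0 add0r.
have tk := t0 k.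
have tk2 : 0 < t k ^+ 2 by rewrite exprn_gt0.
have -> : ybar + (t k * sigma) *: v - (ybar + t k *: y k) =
    t k *: (sigma *: v - y k).
  by rewrite opprD addrACA subrr add0r scalerBr scalerA.
rewrite dotrZr => H; rewrite -(ler_pM2l tk2); apply: le_trans (le_trans _ H) _; last first.
  by rewrite le_eqVlt; apply/orP; left; apply/eqP; rewrite /cst /=; ring.
rewrite -subr_ge0.
have -> : t k * dotr (c i) (y k) + 2^-1 * t k ^+ 2 * dotr (y k *m A i) (y k) +
     t k * (t k * dotr (mu_ k) (sigma *: v - y k)) -
   t k ^+ 2 * (2^-1 * dotr (y k *m A i) (y k) + dotr (mu_ k) (sigma *: v - y k)) =
   t k * dotr (c i) (y k) by ring.
by rewrite mulr_ge0// ltW.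
Unshelve. all: by end_near. Qed.

(** With [v = d] and [sigma = 1 - t], the second-order inequality divided by [t]
  tends to [<d A_i, d> <= <mu, d>] as [t] tends to [0]; on the ray of direction
  [d] the second-order quotients of the gap are equal to [<d A_i, d>]. *)
Lemma second_subderivative_le_derivative_pieces :
  (second_subderivative theta ybar lb d <= (dotr mu d)%:E)%E.
Proof.
have [i [Oy dO cd so]] := derivative_second_order.
have q_le : dotr (d *m A i) d <= dotr mu d.
  rewrite -subr_ge0; apply: (@le0_affine _ _ (2^-1 * dotr (d *m A i) d)) => t.
  move=> /andP[t0 t1]; have s0 : 0 < 1 - t by rewrite subr_gt0.
  have := so i d (1 - t) s0 Oy dO cd.
  rewrite scalerBl scale1r addrAC subrr add0r dotrNr dotrZr -subr_ge0 => H.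
  rewrite -(pmulr_rge0 _ t0); apply: le_trans H _.
  by rewrite le_eqVlt; apply/orP; left; apply/eqP; field.
apply: (second_subderivative_le theta_gtNy lb_sub) => V [[/= V1 V2] [V10 V2d] VV].
near (0 : R)^'+ => t; exists (t, d); split => /=.
- by apply: VV; split => /=; [near: t|exact: nbhs_singleton].
- by [].
- by apply: (@piece_dom i); near: t.
- have td : Omega i (ybar + t *: d) by near: t.
  by rewrite (gap_piece Oy td) cd mulr0 add0r ler_wpM2l// mulr_ge0 ?sqr_ge0// invr_ge0.
Unshelve. all: by end_near. Qed.

(** Here the second-order inequality, with [sigma] tending to [0], says that
  [<mu, v> <= 0] in the feasible directions [v] of zero slope. Moreover,
  [lb + s mu] is a subgradient at [ybar] iff [s mu <= c_i] on the feasible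
  cone of each piece, and Farkas' lemma provides a common positive [s]. *)
Lemma derivative_subgradient_pieces : d = 0 ->
  exists2 s : R, 0 < s & subdifferential theta ybar (lb + s *: mu).
Proof.
move=> d0; have [i0 [_ _ _]] := derivative_second_order.
rewrite d0 dotr0r mulr0 => so.
have gamP i : exists gam : R, 0 <= gam /\ (Omega i ybar -> forall v,
    (\forall t \near 0^'+, Omega i (ybar + t *: v)) ->
    dotr mu v <= gam * dotr (c i) v).
  have [Oy|nOy] := pselect (Omega i ybar); last by exists 0; split.
  have [|gam gam0 H] := @polyhedral_farkas _ _ (Omega i) ybar (c i) mu (Omega_poly i) Oy.
    move=> v vO cv0.
    have cv : dotr (c i) v = 0.
      apply/le_anti/andP; split=> //; near (0 : R)^'+ => t.
      have t0 : 0 < t by [].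
      rewrite -(pmulr_rge0 _ t0) -dotrZr; apply: slope_ge0 => //.
      by near: t.
    rewrite -oppr_ge0; apply: (@le0_affine _ _ (2^-1 * dotr (v *m A i) v)) => t.
    move=> /andP[t0 t1]; have := so i v t t0 Oy vO cv.
    rewrite subr0 add0r dotrZr -subr_ge0 => le.
    rewrite -(pmulr_rge0 _ t0); apply: le_trans le _.
    by rewrite le_eqVlt; apply/orP; left; apply/eqP; ring.
  by exists gam; split.
have [gam gamH] := choice gamP.
pose G := 1 + \sum_i gam i.
have gam0 i : 0 <= gam i by have [] := gamH i.
have G1 : 1 <= G by rewrite lerDl sumr_ge0.
have G0 : 0 < G by exact: lt_le_trans G1.
have gamG i : gam i <= G.
  rewrite /G (bigD1 i)//= addrCA lerDl addr_ge0// sumr_ge0//.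
exists G^-1; first by rewrite invr_gt0.
apply/(subdifferentialP ybar lb theta_gtNy); split=> // z z_dom.
rewrite gap_base add0r addrAC subrr add0r dotrZl ler_pdivrMl//.
set v := z - ybar.
have vdom : \forall t \near (0 : R)^'+, exists i, Omega i (ybar + t *: v).
  near=> t; apply: dom_piece.
  have [] // := gap_segment theta_gtNy theta_convex lb_sub z_dom (t := t).
  by apply/andP; split.
have [i FF] := pigeonhole_filter vdom.
set F := within _ _ in FF.
have tF : (fun t : R => t) @ F --> (0 : R).
  move=> B B0; have : nbhs (0 : R) [set t | 0 < t -> Omega i (ybar + t *: v) -> B t].
    by apply: filterS B0 => t Bt _ _.
  exact.
have tF0 : \forall t \near F, 0 < t.
  have : nbhs (0 : R) [set t | 0 < t -> Omega i (ybar + t *: v) -> 0 < t].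
    by apply: filterE => t t0 _.
  exact.
have OF : \forall t \near F, Omega i (ybar + t *: v) by exact: withinT.
have vF : (fun=> v) @ F --> v by exact: cvg_cst.
have [Oy vO] := polyhedral_tangent (Omega_poly i) tF0 tF vF OF.
have cv0 : 0 <= dotr (c i) v.
  near (0 : R)^'+ => t; have t0 : 0 < t by [].
  by rewrite -(pmulr_rge0 _ t0) -dotrZr; apply: slope_ge0 => //; near: t.
have cz : dotr (c i) v <= gapb z.
  have lF : (fun t => dotr (c i) v + t * (2^-1 * dotr (v *m A i) v)) @ (0 : R)^'+
      --> dotr (c i) v + 0 * (2^-1 * dotr (v *m A i) v).
    apply: cvgD; first exact: cvg_cst.
    apply: cvgM; last exact: cvg_cst.
    exact: cvg_within.
  rewrite mul0r addr0 in lF.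
  apply: le_cvg lF (cvg_cst (gapb z)) _; near=> t.
  have t0 : 0 < t by [].
  have tO : Omega i (ybar + t *: v) by near: t.
  have [|_] := gap_segment theta_gtNy theta_convex lb_sub z_dom (t := t).
    by apply/andP; split.
  rewrite -/v (gap_piece Oy tO) -subr_ge0 => le.
  rewrite -subr_ge0 -(pmulr_rge0 _ t0); apply: le_trans le _.
  by rewrite le_eqVlt; apply/orP; left; apply/eqP; rewrite /cst; ring.
have [_ /(_ Oy v vO) muv] := gamH i.
apply: le_trans muv _; apply: le_trans (ler_wpM2r cv0 (gamG i)) _.
by rewrite ler_pM2l.
Unshelve. all: by end_near. Qed.

End Derivative.

End Pieces.

Hypothesis theta_plq : piecewise_linear_quadratic theta.

Lemma gap_lsc y r : (edom theta y -> r < gapb y) ->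
  \forall y' \near y, edom theta y' -> r < gapb y'.
Proof.
have [k [P [A [a [alpha [poly _ dom thE]]]]]] := theta_plq.
exact: (gap_lsc_pieces poly dom thE).
Qed.

Lemma second_subderivative_le_derivative d mu :
  graphical_derivative (subdifferential theta) ybar lb d mu ->
  (second_subderivative theta ybar lb d <= (dotr mu d)%:E)%E.
Proof.
have [k [P [A [a [alpha [poly sym dom thE]]]]]] := theta_plq.
exact: (second_subderivative_le_derivative_pieces poly sym dom thE).
Qed.

Lemma derivative_subgradient mu :
  graphical_derivative (subdifferential theta) ybar lb 0 mu ->
  exists2 s : R, 0 < s & subdifferential theta ybar (lb + s *: mu).
Proof.
have [k [P [A [a [alpha [poly sym dom thE]]]]]] := theta_plq.
move=> dmu; exact: (derivative_subgradient_pieces poly sym dom thE dmu).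
Qed.

End PiecewiseLinearQuadratic.

(** * Compactness *)

Section Compactness.
Context {R : realType}.

Lemma closed_ball_compact n (a : 'rV[R]_n) (r : R) :
  compact [set x | `|x - a| <= r].
Proof.
apply: bounded_closed_compact.
  exists (r + `|a|); split; first exact: num_real.
  move=> M rM x /= xr; rewrite -(subrK a x) (le_trans (ler_normD _ _))//.
  by rewrite (le_trans _ (ltW rM))// lerD2r.
apply: (@closed_comp _ _ (fun x : 'rV[R]_n => `|x - a|) [set y | y <= r]).
  move=> x _; have xa : (fun y : 'rV[R]_n => y - a) @ nbhs x --> x - a.
    by apply: cvgB; [exact: cvg_id|exact: cvg_cst].
  exact: cvg_norm xa.
exact: closed_le.
Qed.

Lemma closed_sphere {V : normedModType R} (r : R) : closed [set x : V | `|x| = r].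
Proof.
apply: (@closed_comp _ _ (fun x : V => `|x|) [set y | y = r]).
  by move=> x _; exact: norm_continuous.
exact: closed_eq.
Qed.

Lemma sphere_compact n (r : R) : compact [set x : 'rV[R]_n | `|x| = r].
Proof.
apply: (@subclosed_compact _ _ [set x : 'rV[R]_n | `|x - 0| <= r]).
- exact: closed_sphere.
- exact: closed_ball_compact.
- by move=> x /= <-; rewrite subr0.
Qed.

Lemma pair_norm_le {V W : normedModType R} (p : V * W) e :
  (`|p| <= e) = (`|p.1| <= e) && (`|p.2| <= e).
Proof. by rewrite prod_normE ge_max. Qed.

Lemma pair_sphere_compact n m (r : R) :
  compact [set p : 'rV[R]_n * 'rV[R]_m | `|p| = r].
Proof.
apply: (@subclosed_compact _ _ ([set x : 'rV[R]_n | `|x - 0| <= r] `*`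
                                [set x : 'rV[R]_m | `|x - 0| <= r])).
- exact: closed_sphere.
- by apply: compact_setX; exact: closed_ball_compact.
move=> p /= pr; have : `|p| <= r by rewrite pr.
by rewrite pair_norm_le !subr0 => /andP.
Qed.

(** A covering argument that replaces the extraction of convergent subsequences:
  the filter [F] stands for the vanishing parameters of the problem. *)
Lemma compact_eventually {X : topologicalType} (K : set X) {I}
    (F : set_system I) {FF : Filter F} (P : I -> X -> Prop) :
  compact K ->
  (forall x, K x -> \forall p \near filter_prod F (nbhs x), P p.1 p.2) ->
  \forall i \near F, forall x, K x -> P i x.
Proof.
move=> /compact_near_coveringP/(_ _ F P FF) cK KP.
have /cK : forall x, K x -> \forall x' \near x & i \near F, P i x'.
  move=> x /KP[[A B] [/= FA xB] AB]; exists (B, A) => // -[y i] [/= By Ai].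
  exact: (AB (i, y)).
by apply: filterS => i iP x /iP.
Qed.

(** A lower semicontinuous function on [K `&` Omega] attains its minimum: if
  the infimum [v] were not attained, some [c > v] would be a lower bound. *)
Lemma compact_lsc_min {X : topologicalType} (K Omega : set X) (h : X -> R) :
  compact K -> (exists x, K x /\ Omega x) ->
  (forall x c, K x -> (Omega x -> c < h x) ->
     \forall x' \near x, Omega x' -> c < h x') ->
  exists x, [/\ K x, Omega x & forall x', K x' -> Omega x' -> h x <= h x'].
Proof.
move=> cK [x0 [Kx0 Ox0]] lsc; apply: contrapT => nmin.
pose S := h @` (K `&` Omega).
have S0 : S !=set0 by exists (h x0), x0.
have cover (F : set_system R) (FF : Filter F) :
    (forall x, K x -> exists2 c, (Omega x -> c < h x) & \forall c' \near F, c' < c) ->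
    \forall c \near F, forall x, K x -> Omega x -> c < h x.
  move=> KF; apply: compact_eventually => // x Kx.
  have [c xc cF] := KF x Kx.
  exists ([set c' | c' < c], [set x' | Omega x' -> c < h x']).
    by split => //=; exact: lsc.
  by move=> -[c' x'] /= [c'c x'c] Ox'; exact: lt_trans c'c (x'c Ox').
have [c cS] : exists c, forall x, K x -> Omega x -> c < h x.
  apply: (@filter_ex _ (ninfty_nbhs R)).
  apply: (cover (ninfty_nbhs R)) => x Kx.
  exists (h x - 1); first by move=> _; lra.
  exact: (nbhs_ninfty_lt (num_real (h x - 1))).
have Slb : has_lbound S by exists c => _ [x [Kx Ox] <-]; exact/ltW/cS.
have vS x : K x -> Omega x -> inf S < h x.
  move=> Kx Ox; rewrite lt_neqAle; apply/andP; split; last first.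
    by apply: ge_inf => //; exists x.
  apply/eqP => vx; apply: nmin; exists x; split=> // x' Kx' Ox'.
  by rewrite -vx; apply: ge_inf => //; exists x'.
have [c' [c'v c'S]] : exists c', inf S < c' /\ forall x, K x -> Omega x -> c' < h x.
  apply: (@filter_ex _ (inf S)^'+); apply: filterI; first exact: (nbhs_right_gt (inf S)).
  apply: (cover (inf S)^'+) => x Kx.
  have [Ox|nOx] := pselect (Omega x); last first.
    by exists (inf S + 1) => //; apply: nbhs_right_lt; rewrite ltrDl.
  have := vS x Kx Ox => vx; exists (2^-1 * (inf S + h x)); first by move=> _; lra.
  by apply: nbhs_right_lt; lra.
have : c' <= inf S by apply: lb_le_inf => // _ [x [Kx Ox] <-]; exact/ltW/c'S.
by rewrite leNgt c'v.
Qed.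

(** The tangent cone is defined by sequences; excluding a tangent direction
  excludes a whole neighbourhood of steps and directions. *)
Lemma not_tangent_near {V : normedModType R} (Omega : set V) (x w : V) :
  ~ tangent_cone Omega x w ->
  \forall p \near filter_prod 0^'+ (nbhs w), ~ Omega (x + p.1 *: p.2).
Proof.
move=> nT; apply: contrapT => nP; apply: nT.
have ex k : exists p : R * V, [/\ 0 < p.1, p.1 < k.+1%:R^-1,
    `|p.2 - w| < k.+1%:R^-1 & Omega (x + p.1 *: p.2)].
  have k0 : 0 < k.+1%:R^-1 :> R by rewrite invr_gt0.
  apply: contrapT => nex; apply: nP; near=> p => Op; apply: nex; exists p.
  split=> //.
  - by near: p; exact: (near_fst (nbhs_right_gt 0)).
  - by near: p; exact: (near_fst (nbhs_right_lt k0)).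
  - by near: p; exact: (near_snd (near_norm_lt w k0)).
have [p pP] := choice ex.
have inv0 : (fun k => k.+1%:R^-1 : R) @ \oo --> (0 : R) by exact: cvg_harmonic.
exists (fun k => (p k).1), (fun k => (p k).2); split.
- by move=> k; have [] := pP k.
- have le k : 0 <= (p k).1 <= k.+1%:R^-1 by have [/ltW -> /ltW ->] := pP k.
  by apply: squeeze_cvgr (cvg_cst 0) inv0; near=> k; exact: le.
- apply/cvgrPdist_lt => /= e e0; near=> k.
  have [_ _ pw _] := pP k; rewrite distrC; apply: lt_trans pw _.
  by near: k; apply: (cvgr_lt 0).
- by move=> k; have [] := pP k.
Unshelve. all: by end_near. Qed.

End Compactness.

(** * Sufficiency of the second-order condition and the qualification condition *)

Section Composite.
Context {R : realType} {n m : nat}.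
Variables (phi0 : 'rV[R]_n -> R) (f : 'rV[R]_n -> 'rV[R]_m).
Variables (theta : 'rV[R]_m -> \bar R) (xbar : 'rV[R]_n) (lb : 'rV[R]_m).
Hypothesis phi0_C2 : C2_around phi0 xbar.
Hypothesis f_C2 : C2_around f xbar.
Hypothesis theta_gtNy : forall y, (-oo < theta y)%E.
Hypothesis stationary : grad_lagrangian phi0 f xbar lb = 0.
Hypothesis lb_sub : subdifferential theta (f xbar) lb.

Let ybar := f xbar.
Let J := 'J f xbar.
Let H := hess_lagrangian phi0 f xbar lb.
Let g x := grad_lagrangian phi0 f x lb.
Local Notation ell := (lagrangian phi0 f lb).
Let D := second_subderivative theta ybar lb.
Local Notation gapb := (gap theta ybar lb).
Let ybar_dom : edom theta ybar := lb_sub.1.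

Lemma constraint_expansion e : 0 < e -> \forall x \near xbar,
  `|f x - f xbar - (x - xbar) *m 'J f xbar| <= e * `|x - xbar|.
Proof.
move=> e0; have [df _ _] := nbhs_singleton f_C2.
apply: filterS (differentiable_norm_le df e0) => x.
by rewrite /jacobian mul_rV_lin1.
Qed.

Lemma lagrangian_expansion e : 0 < e -> \forall x \near xbar,
  `|ell x - ell xbar - 2^-1 * dotr ((x - xbar) *m H) (x - xbar)|
    <= e * `|x - xbar| ^+ 2.
Proof.
apply: (second_order_expansion (g := g)).
  exact: lagrangian_is_derive.
move=> e' e'0; apply: filterS (grad_lagrangian_expansion lb phi0_C2 f_C2 e'0) => x.
by rewrite stationary subr0.
Qed.

Lemma grad_lagrangianE x l :
  grad_lagrangian phi0 f x l = g x + (l - lb) *m ('J f x)^T.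
Proof. by rewrite /g /grad_lagrangian -addrA -mulmxDl [lb + _]addrC subrK. Qed.

Lemma objectiveE x : edom theta (f x) ->
  ((phi0 x)%:E + theta (f x))%E =
  (ell x + gapb (f x) + (fine (theta ybar) - dotr lb ybar))%:E.
Proof.
move=> x_dom; rewrite (fine_theta theta_gtNy x_dom) -EFinD /gap /lagrangian !dotr_lin.
by congr _%:E; ring.
Qed.

Lemma local_minimizerP : local_minimizer phi0 theta f xbar <->
  \forall x \near xbar, edom theta (f x) -> ell xbar <= ell x + gapb (f x).
Proof.
split; apply: filterS => x.
  by move=> + x_dom; rewrite !objectiveE// lee_fin gap_base; lra.
move=> xP; have [x_dom|x_dom] := pselect (edom theta (f x)).
  by have := xP x_dom; rewrite !objectiveE// lee_fin gap_base; lra.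
by rewrite (not_edom x_dom) addey ?leey.
Qed.

(** The restriction to the critical cone can be dropped, since outside of it the
  second subderivative is infinite. *)
Lemma second_order_sufficientP : second_order_sufficient phi0 theta f xbar lb <->
  forall w : 'rV[R]_n, w != 0 -> forall a : R, (D (w *m J) <= a%:E)%E -> 0 < a + dotr (w *m H) w.
Proof.
split=> sosc w w0.
  move=> a Da; have := sosc w w0 (second_subderivative_critical theta_gtNy lb_sub Da).
  move=> /lt_le_trans/(_ (leeD2r _ Da)); rewrite -EFinD lte_fin; exact.
move=> _; rewrite -/D -/J -/H; case DE : (D (w *m J)) => [a| |].
- by rewrite -EFinD lte_fin; apply: sosc; rewrite ?DE.
- by rewrite addye ?ltry.
- have := sosc w w0 (- dotr (w *m H) w); rewrite DE leNye => /(_ isT).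
  by rewrite addNr ltxx.
Qed.

(** Steps near the direction [w] become, through [f], steps near the direction
  [w J], so that lower limits along the latter apply to [gap (f x)]. *)
Lemma cvg_constraint_direction (w : 'rV[R]_n) :
  (fun p : R * 'rV[R]_n => (p.1, p.1^-1 *: (f (xbar + p.1 *: p.2) - ybar)))
    @ filter_prod 0^'+ (nbhs w) --> filter_prod 0^'+ (nbhs (w *m J)).
Proof.
have tF : (fun p : R * 'rV[R]_n => p.1) @ filter_prod 0^'+ (nbhs w) --> (0 : R)^'+.
  exact: cvg_fst.
have fF : (fun p : R * 'rV[R]_n => p.1^-1 *: (f (xbar + p.1 *: p.2) - ybar))
    @ filter_prod 0^'+ (nbhs w) --> w *m J.
  by apply: cvg_first_quotient; exact: constraint_expansion.
exact: (cvg_pair tF fF).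
Qed.

(** The sum of the second-order lower bounds for the smooth part and for the gap
  at the moving point [f (xbar + t w')]. *)
Lemma sosc_growth : second_order_sufficient phi0 theta f xbar lb ->
  forall w : 'rV[R]_n, w != 0 -> \forall p \near filter_prod 0^'+ (nbhs w),
    edom theta (f (xbar + p.1 *: p.2)) ->
    ell xbar <= ell (xbar + p.1 *: p.2) + gapb (f (xbar + p.1 *: p.2)).
Proof.
move=> /second_order_sufficientP sosc w w0.
have [a qa aD] : exists2 a : R, - dotr (w *m H) w < a & (a%:E < D (w *m J))%E.
  apply: lt_EFin_between; rewrite ltNge; apply/negP => Dq.
  by have := sosc w w0 _ Dq; rewrite addNr ltxx.
have aG := cvg_constraint_direction (second_subderivative_gt theta_gtNy lb_sub aD).
have lG := cvg_second_quotient (w := w) lagrangian_expansion.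
have ltq : - (2^-1 * a) < 2^-1 * dotr (w *m H) w by lra.
near=> p => p_dom.
have p1 : 0 < p.1 by near: p; exact: (near_fst (nbhs_right_gt 0)).
have lp : - (2^-1 * a) < (p.1 ^+ 2)^-1 * (ell (xbar + p.1 *: p.2) - ell xbar).
  by near: p; exact: (cvgr_gt _ lG).
have gp : edom theta (ybar + p.1 *: (p.1^-1 *: (f (xbar + p.1 *: p.2) - ybar))) ->
    2^-1 * p.1 ^+ 2 * a <
    gapb (ybar + p.1 *: (p.1^-1 *: (f (xbar + p.1 *: p.2) - ybar))).
  by near: p; exact: aG.
have fE : ybar + p.1 *: (p.1^-1 *: (f (xbar + p.1 *: p.2) - ybar)) =
    f (xbar + p.1 *: p.2).
  by rewrite scalerA mulfV ?gt_eqF// scale1r addrC subrK.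
rewrite fE in gp; have := gp p_dom.
have p2 : 0 < p.1 ^+ 2 by rewrite exprn_gt0.
move: lp; rewrite ltr_pdivlMl//; lra.
Unshelve. all: by end_near. Qed.

Lemma sosc_local_minimizer :
  second_order_sufficient phi0 theta f xbar lb -> local_minimizer phi0 theta f xbar.
Proof.
move=> sosc; apply/local_minimizerP.
pose P (t : R) w := edom theta (f (xbar + t *: w)) ->
  ell xbar <= ell (xbar + t *: w) + gapb (f (xbar + t *: w)).
have : \forall t \near (0 : R)^'+, forall w, `|w| = 1 -> P t w.
  apply: compact_eventually; first exact: sphere_compact.
  by move=> w w1; apply: sosc_growth => //; rewrite -normr_eq0 w1 oner_eq0.
move=> /near_norm_ltP[r r0 rP]; apply/near_norm_ltP; exists r => // x xr.
have [->|xx] := eqVneq x xbar; first by rewrite gap_base addr0.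
have x0 : 0 < `|x - xbar| by rewrite normr_gt0 subr_eq0.
have := rP `|x - xbar|; rewrite subr0 normr_id => /(_ xr x0 (`|x - xbar|^-1 *: (x - xbar))).
rewrite /P scalerA mulfV ?gt_eqF// scale1r [xbar + _]addrC subrK; apply.
by rewrite /= normrZ normrV ?unitfE ?gt_eqF// normr_id mulVf ?gt_eqF.
Qed.

(** The blow-up of the generalized equation along a direction [(w, mu)]. If
  [w H + mu J^T] is nonzero, the first residual is too large; otherwise
  [<w H, w> + <mu, w J> = 0], and the second-order condition and the constraint
  qualification exclude that [mu] is a derivative of the subdifferential in
  direction [w J]. *)
Lemma sosc_blowup (w : 'rV[R]_n) (mu : 'rV[R]_m) :
  piecewise_linear_quadratic theta ->
  second_order_sufficient phi0 theta f xbar lb ->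
  strong_Robinson_CQ theta f xbar lb -> `|(w, mu)| = 1 ->
  \forall p \near filter_prod (filter_prod (0 : R)^'+
      (nbhs (0 : 'rV[R]_n * 'rV[R]_m))) (nbhs (w, mu)),
    ~ (grad_lagrangian phi0 f (xbar + p.1.1 *: p.2.1) (lb + p.1.1 *: p.2.2)
         = p.1.1 *: p.1.2.1 /\
       subdifferential theta (f (xbar + p.1.1 *: p.2.1) + p.1.1 *: p.1.2.2)
         (lb + p.1.1 *: p.2.2)).
Proof.
move=> plq /second_order_sufficientP sosc srcq wmu1.
set F := filter_prod _ _.
pose Z := ((R * ('rV[R]_n * 'rV[R]_m)) * ('rV[R]_n * 'rV[R]_m))%type.
have tF : (fun p : Z => p.1.1) @ F --> (0 : R)^'+.
  exact: cvg_comp cvg_fst cvg_fst.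
have rvF : (fun p : Z => p.1.2) @ F --> (0 : 'rV[R]_n * 'rV[R]_m).
  exact: cvg_comp cvg_fst cvg_snd.
have rF : (fun p : Z => p.1.2.1) @ F --> (0 : 'rV[R]_n).
  exact: cvg_comp rvF cvg_fst.
have vF : (fun p : Z => p.1.2.2) @ F --> (0 : 'rV[R]_m).
  exact: cvg_comp rvF cvg_snd.
have zF : (fun p : Z => p.2) @ F --> (w, mu) by exact: cvg_snd.
have wF : (fun p : Z => p.2.1) @ F --> w by exact: cvg_comp zF cvg_fst.
have muF : (fun p : Z => p.2.2) @ F --> mu by exact: cvg_comp zF cvg_snd.
have twF : (fun p : Z => (p.1.1, p.2.1)) @ F --> filter_prod (0 : R)^'+ (nbhs w).
  exact: (cvg_pair tF wF).
have twC (V : Type) (h : R * 'rV[R]_n -> V) (G : set_system V) :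
    h @ filter_prod 0^'+ (nbhs w) --> G ->
    (fun p : Z => h (p.1.1, p.2.1)) @ F --> G.
  by move=> hG; exact: (cvg_comp _ _ twF hG).
have xF : (fun p : Z => xbar + p.1.1 *: p.2.1) @ F --> xbar.
  exact: (twC _ (fun q => xbar + q.1 *: q.2) _ (@cvg_shift_scale R _ xbar w)).
have gF : (fun p : Z => p.1.1^-1 *: (g (xbar + p.1.1 *: p.2.1) - g xbar)) @ F
    --> w *m H.
  apply: (twC _ (fun q => q.1^-1 *: (g (xbar + q.1 *: q.2) - g xbar))).
  by apply: cvg_first_quotient => e e0; exact: grad_lagrangian_expansion.
have fF : (fun p : Z => p.1.1^-1 *: (f (xbar + p.1.1 *: p.2.1) - ybar)) @ F
    --> w *m J.
  apply: (twC _ (fun q => q.1^-1 *: (f (xbar + q.1 *: q.2) - ybar))).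
  by apply: cvg_first_quotient; exact: constraint_expansion.
have JF : (fun p : Z => 'J f (xbar + p.1.1 *: p.2.1)) @ F --> J.
  exact: (cvg_comp _ _ xF (jacobian_cvg f_C2)).
have t0 : \forall p \near F, 0 < p.1.1 by exact: (tF _ (nbhs_right_gt 0)).
have [N0|N0] := eqVneq (w *m H + mu *m J^T) 0; last first.
  have resF (a : Z -> 'rV[R]_n) (B : Z -> 'M[R]_(n, m)) :
      a @ F --> w *m H -> B @ F --> J ->
      (fun p : Z => a p + p.2.2 *m (B p)^T - p.1.2.1) @ F
        --> w *m H + mu *m J^T.
    move=> aF BF; rewrite -[X in _ --> X]subr0.
    exact: (cvgB (cvgD aF (cvg_mulmx muF (cvg_trmx BF))) rF).
  have NF := resF _ _ gF JF.
  apply: filterS2 t0 (cvgr_neq0 _ NF N0) => p p0 /eqP pN [gE _]; apply: pN.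
  have gx0 : g xbar = 0 by exact: stationary.
  move: gE; rewrite grad_lagrangianE [lb + _ - lb]addrAC subrr add0r gx0 subr0.
  move: (g (xbar + p.1.1 *: p.2.1)) => gx gE.
  apply: (scalerI (lt0r_neq0 p0)); rewrite scaler0 !(scalerBr, scalerDr) scalerA.
  by rewrite mulfV ?gt_eqF// scale1r scalemxAl gE subrr.
have nT : ~ tangent_cone (gph (subdifferential theta)) (ybar, lb) (w *m J, mu).
  move=> T; have [w0|w0] := eqVneq w 0.
    move: N0 T wmu1; rewrite w0 !mul0mx add0r => muJ T.
    have : [set 0 : 'rV[R]_m] mu by rewrite -srcq.
    move=> /= ->; have -> : ((0 : 'rV[R]_n), (0 : 'rV[R]_m)) = 0 by [].
    by rewrite normr0 => /eqP; rewrite eq_sym oner_eq0.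
  have := sosc w w0 _ (second_subderivative_le_derivative theta_gtNy lb_sub plq T).
  move/(congr1 (fun v => dotr v w)): N0; rewrite dotrDl dotr0l [dotr (mu *m _) _]dotr_mulmx trmxK.
  by rewrite addrC => ->; rewrite ltxx.
have TF : (fun p : Z => (p.1.1,
    (p.1.1^-1 *: (f (xbar + p.1.1 *: p.2.1) - ybar) + p.1.2.2, p.2.2))) @ F
    --> filter_prod (0 : R)^'+ (nbhs (w *m J, mu)).
  have yF : (fun p : Z => p.1.1^-1 *: (f (xbar + p.1.1 *: p.2.1) - ybar) + p.1.2.2)
      @ F --> w *m J by rewrite -[X in _ --> X]addr0; exact: (cvgD fF vF).
  have ymF : (fun p : Z => (p.1.1^-1 *: (f (xbar + p.1.1 *: p.2.1) - ybar) + p.1.2.2,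
      p.2.2)) @ F --> (w *m J, mu) by exact: (cvg_pair yF muF).
  exact: (cvg_pair tF ymF).
have := TF _ (not_tangent_near nT); apply: filterS2 t0 => p p0 nsub [_ sub].
apply: nsub; rewrite /gph /=.
by rewrite scalerDr scalerA mulfV ?gt_eqF// scale1r addrA [ybar + _]addrC subrK.
Qed.

Lemma KKT_mapping_base : KKT_mapping phi0 theta f (xbar, lb) (0, 0).
Proof. by exists ybar; rewrite //= stationary addNr. Qed.

Lemma edist_ge0 {V : normedModType R} (y : V) (A : set V) : (0 <= edist_set y A)%E.
Proof. by apply: le_ereal_inf_tmp => _ [z _ <-]; rewrite lee_fin. Qed.

(** Scaling by [t = |(x, l) - (xbar, lb)|]: the pair is [(xbar, lb)] plus [t] times
  a unit vector, and residuals smaller than [r t] are [t] times small vectors,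
  so the exclusion of solutions of the blown-up equation, uniform on the sphere,
  is the estimate with constant [1 / r]. *)
Lemma sosc_subregular : piecewise_linear_quadratic theta ->
  second_order_sufficient phi0 theta f xbar lb ->
  strong_Robinson_CQ theta f xbar lb ->
  strongly_metrically_subregular (KKT_mapping phi0 theta f) (xbar, lb) (0, 0).
Proof.
move=> plq sosc srcq; split; first exact: KKT_mapping_base.
pose P (i : R * ('rV[R]_n * 'rV[R]_m)) (z : 'rV[R]_n * 'rV[R]_m) :=
  ~ (grad_lagrangian phi0 f (xbar + i.1 *: z.1) (lb + i.1 *: z.2) = i.1 *: i.2.1 /\
     subdifferential theta (f (xbar + i.1 *: z.1) + i.1 *: i.2.2) (lb + i.1 *: z.2)).
have : \forall i \near filter_prod (0 : R)^'+ (nbhs (0 : 'rV[R]_n * 'rV[R]_m)),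
    forall z, `|z| = 1 -> P i z.
  apply: compact_eventually; first exact: pair_sphere_compact.
  by move=> [w mu] wmu; exact: sosc_blowup.
move=> [[/= A B] [/near_norm_ltP[r1 r10 Ar1] /near_norm_ltP[r2 r20 Br2]] AB].
pose r := Num.min r1 r2.
have r0 : 0 < r by rewrite lt_min r10.
exists r^-1; first by rewrite invr_ge0 ltW.
apply/near_norm_ltP; exists r => // -[x l] xlr.
set t := `|(x, l) - (xbar, lb)| in xlr *.
have [t0|t0] := eqVneq t 0; first by rewrite t0 mule_ge0 ?edist_ge0// lee_fin invr_ge0 ltW.
have tp : 0 < t by rewrite lt_neqAle eq_sym t0 normr_ge0.
set E := edist_set _ _.
suff : ((r * t)%:E <= E)%E.
  have ri : (0 <= r^-1%:E)%E by rewrite lee_fin invr_ge0 ltW.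
  move=> /(lee_wpmul2l ri); apply: le_trans.
  by rewrite -EFinM lee_fin mulrA mulVf ?gt_eqF// mul1r.
apply: le_ereal_inf_tmp => _ [_ [y /= ysub <-] <-]; rewrite lee_fin leNgt.
apply/negP => /=; set r' := grad_lagrangian _ _ _ _; set v' := - f x + y => small.
have small' : `|(r', v')| < r * t.
  by move: small; rewrite -normrN opprB; congr (`|_| < _); rewrite subr0.
have zx : xbar + t *: (t^-1 *: (x - xbar)) = x.
  by rewrite scalerA mulfV// scale1r addrC subrK.
have zl : lb + t *: (t^-1 *: (l - lb)) = l.
  by rewrite scalerA mulfV// scale1r addrC subrK.
have := AB (t, (t^-1 *: r', t^-1 *: v')) _ (t^-1 *: (x - xbar), t^-1 *: (l - lb)).
apply.
- split=> /=.
    by apply: Ar1 => //; rewrite subr0 gtr0_norm// (lt_le_trans xlr)// ge_min lexx.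
  apply: Br2; rewrite subr0.
  have -> : (t^-1 *: r', t^-1 *: v') = t^-1 *: (r', v') by [].
  rewrite normrZ gtr0_norm ?invr_gt0// ltr_pdivrMl// mulrC.
  by apply: lt_le_trans small' _; rewrite ler_pM2r// ge_min lexx orbT.
- have -> : (t^-1 *: (x - xbar), t^-1 *: (l - lb)) = t^-1 *: ((x, l) - (xbar, lb)) by [].
  by rewrite normrZ gtr0_norm ?invr_gt0// mulVf.
- rewrite /= zx zl !scalerA mulfV// !scale1r; split=> //.
  by rewrite /v' addrA subrr add0r.
Qed.

End Composite.

(** * Consequences of subregularity at a local minimizer *)

Section Necessity.
Context {R : realType} {n m : nat}.
Variables (phi0 : 'rV[R]_n -> R) (f : 'rV[R]_n -> 'rV[R]_m).
Variables (theta : 'rV[R]_m -> \bar R) (xbar : 'rV[R]_n) (lb : 'rV[R]_m).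
Hypothesis phi0_C2 : C2_around phi0 xbar.
Hypothesis f_C2 : C2_around f xbar.
Hypothesis theta_gtNy : forall y, (-oo < theta y)%E.
Hypothesis theta_convex : econvex theta.
Hypothesis theta_plq : piecewise_linear_quadratic theta.
Hypothesis stationary : grad_lagrangian phi0 f xbar lb = 0.
Hypothesis lb_sub : subdifferential theta (f xbar) lb.

Let ybar := f xbar.
Let J := 'J f xbar.
Let H := hess_lagrangian phi0 f xbar lb.
Let g x := grad_lagrangian phi0 f x lb.
Local Notation ell := (lagrangian phi0 f lb).
Local Notation gapb := (gap theta ybar lb).
Let ybar_dom : edom theta ybar := lb_sub.1.

(* The inequalities that matter are passed explicitly at each use. *)
Local Ltac section_lra :=
  clear -phi0_C2 f_C2 theta_gtNy theta_convex theta_plq stationary lb_sub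
         ybar J H g ybar_dom; lra.

Lemma subdifferential_segment y l t : subdifferential theta y lb ->
  subdifferential theta y l -> 0 <= t <= 1 ->
  subdifferential theta y (lb + t *: (l - lb)).
Proof.
move=> /(subdifferentialP ybar lb theta_gtNy)[y_dom lbP].
move=> /(subdifferentialP ybar lb theta_gtNy)[_ lP] /andP[t0 t1].
apply/(subdifferentialP ybar lb theta_gtNy); split=> // z z_dom.
have := lbP z z_dom; have := lP z z_dom; rewrite subrr dotr0l addr0.
by rewrite [lb + _ - lb]addrAC subrr add0r dotrZl; nra.
Qed.

Lemma multipliersP l : multipliers theta f xbar (- gradient phi0 xbar) l <->
  (l - lb) *m J^T = 0 /\ subdifferential theta ybar l.
Proof.
have lbJ : lb *m J^T = - gradient phi0 xbar.
  by apply/eqP; rewrite -subr_eq0 opprK addrC; apply/eqP.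
by split=> -[lJ lsub]; split=> //; apply/eqP; move: lJ;
  rewrite mulmxBl lbJ => /eqP; rewrite subr_eq0.
Qed.

Lemma multiplier_base : multipliers theta f xbar (- gradient phi0 xbar) lb.
Proof. by apply/multipliersP; rewrite subrr mul0mx. Qed.

(** The segment from [lb] to another multiplier consists of zeros of the
  mapping. *)
Lemma subregular_unique_multiplier :
  strongly_metrically_subregular (KKT_mapping phi0 theta f) (xbar, lb) (0, 0) ->
  multipliers theta f xbar (- gradient phi0 xbar) = [set lb].
Proof.
move=> [_ [kappa kappa0 /near_norm_ltP[r r0 sub]]].
apply/seteqP; split=> [l|_ ->]; last exact: multiplier_base.
move=> /multipliersP[lJ lsub] /=; apply/eqP; rewrite -subr_eq0; apply/eqP.
apply: contrapT => /eqP ll; have l0 : 0 < `|l - lb| by rewrite normr_gt0.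
pose t := Num.min 1 (2^-1 * (r / `|l - lb|)).
have t0 : 0 < t by rewrite lt_min ltr01/= mulr_gt0// divr_gt0.
have tE : (xbar, lb + t *: (l - lb)) - (xbar, lb) = (0, t *: (l - lb)).
  by congr (_, _); rewrite /= ?subrr// addrAC subrr add0r.
have tN : `|((0 : 'rV[R]_n), t *: (l - lb))| = t * `|l - lb|.
  by rewrite prod_normE /= normr0 normrZ gtr0_norm// max_r// mulr_ge0// ltW.
have := sub (xbar, lb + t *: (l - lb)).
rewrite tE tN => /(_ _)/=.
have tr : t * `|l - lb| < r.
  apply: (@le_lt_trans _ _ (2^-1 * (r / `|l - lb|) * `|l - lb|)).
    by rewrite ler_pM2r// ge_min lexx orbT.
  by rewrite -mulrA divfK ?gt_eqF//; lra.
move=> /(_ tr); apply/negP; rewrite -ltNge.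
set E := edist_set _ _.
have E0 : (E <= 0)%E.
  apply: ge_ereal_inf; exists 0%E => //; exists (0, 0); last by rewrite subrr normr0.
  exists ybar => /=.
    apply: (subdifferential_segment lb_sub lsub).
    by rewrite (ltW t0)/= ge_min lexx.
  rewrite (grad_lagrangianE _ _ lb) stationary add0r [lb + _ - lb]addrAC subrr add0r.
  by rewrite -scalemxAl lJ scaler0 addNr.
have : (kappa%:E * E <= 0)%E by rewrite mule_ge0_le0// lee_fin.
move=> /le_lt_trans; apply; rewrite lte_fin; exact: mulr_gt0.
Qed.

Lemma grad_lagrangian_cvg0 : g @ xbar --> (0 : 'rV[R]_n).
Proof.
rewrite -stationary; apply: (@cvg_expansion R n n g xbar H) => e e0.
exact: grad_lagrangian_expansion.
Qed.

(** If an approximate multiplier [l] of a nearby point were far from [lb], its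
  truncation [lb + mu] to the sphere [|mu| = e] would satisfy
  [<mu, z - y> <= gap z] for all [z]; by compactness of the sphere, a limit of
  such [lb + mu] would be a second multiplier. *)
Lemma multiplier_stability :
  multipliers theta f xbar (- gradient phi0 xbar) = [set lb] ->
  forall e, 0 < e -> exists2 d : R, 0 < d & forall x y l,
    `|x - xbar| < d -> `|y - ybar| < d -> `|grad_lagrangian phi0 f x l| < d ->
    subdifferential theta y l -> `|l - lb| < e.
Proof.
move=> uniq e e0.
pose P (i : ('rV[R]_n * 'rV[R]_m) * R) (mu : 'rV[R]_m) :=
  ~ (`|mu *m ('J f i.1.1)^T| <= i.2 + `|g i.1.1| /\
     forall z, edom theta z -> dotr mu (z - i.1.2) <= gapb z).
have : \forall i \near filter_prod (filter_prod (nbhs xbar) (nbhs ybar)) (nbhs (0 : R)),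
    forall mu : 'rV[R]_m, `|mu| = e -> P i mu.
  apply: compact_eventually; first exact: sphere_compact.
  move=> mu muE; set F := filter_prod _ _.
  pose Z := ((('rV[R]_n * 'rV[R]_m) * R) * 'rV[R]_m)%type.
  have xyF : (fun p : Z => p.1.1) @ F --> filter_prod (nbhs xbar) (nbhs ybar).
    exact: cvg_comp cvg_fst cvg_fst.
  have xF : (fun p : Z => p.1.1.1) @ F --> xbar by exact: cvg_comp xyF cvg_fst.
  have yF : (fun p : Z => p.1.1.2) @ F --> ybar by exact: cvg_comp xyF cvg_snd.
  have eF : (fun p : Z => p.1.2) @ F --> (0 : R) by exact: cvg_comp cvg_fst cvg_snd.
  have muF : (fun p : Z => p.2) @ F --> mu by exact: cvg_snd.
  have [muJ|muJ] := eqVneq (mu *m J^T) 0; last first.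
    have JF : (fun p : Z => 'J f p.1.1.1) @ F --> J.
      exact: (cvg_comp _ _ xF (jacobian_cvg f_C2)).
    have gF : (fun p : Z => `|g p.1.1.1|) @ F --> `|0 : 'rV[R]_n|.
      exact: (cvg_norm (cvg_comp _ _ xF grad_lagrangian_cvg0)).
    rewrite normr0 in gF.
    have lF : (fun p : Z => `|p.2 *m ('J f p.1.1.1)^T|) @ F --> `|mu *m J^T|.
      exact: (cvg_norm (cvg_mulmx muF (cvg_trmx JF))).
    have rF : (fun p : Z => p.1.2 + `|g p.1.1.1|) @ F --> (0 : R).
      by rewrite -[X in _ --> X]addr0; exact: (cvgD eF gF).
    have muJ0 : 0 < 2^-1 * `|mu *m J^T| by rewrite mulr_gt0 ?invr_gt0// normr_gt0.
    have muJ1 : 2^-1 * `|mu *m J^T| < `|mu *m J^T| by rewrite gtr_pMl ?normr_gt0//; lra.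
    have rn : \forall p \near F, p.1.2 + `|g p.1.1.1| < 2^-1 * `|mu *m J^T|.
      exact: (cvgr_lt _ rF _ muJ0).
    have ln : \forall p \near F, 2^-1 * `|mu *m J^T| < `|p.2 *m ('J f p.1.1.1)^T|.
      exact: (cvgr_gt _ lF _ muJ1).
    apply: filterS2 rn ln => p rp lp [pP _].
    by have := lt_le_trans lp pP; rewrite ltNge (ltW rp).
  have [z [z_dom zP]] : exists z, edom theta z /\ gapb z < dotr mu (z - ybar).
    apply: contrapT => nz; have : [set lb] (lb + mu).
      rewrite -uniq; apply/multipliersP.
      rewrite [lb + mu]addrC addrK; split=> //.
      apply/(subdifferentialP ybar lb theta_gtNy); split=> // z z_dom.
      rewrite gap_base add0r addrK leNgt; apply/negP => zP.
      by apply: nz; exists z.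
    move=> /= /eqP; rewrite -subr_eq0 [lb + mu]addrC addrK => /eqP mu0.
    by move: muE; rewrite mu0 normr0 => e0'; move: e0; rewrite -e0' ltxx.
  have zF : (fun p : Z => dotr p.2 (z - p.1.1.2)) @ F --> dotr mu (z - ybar).
    by apply: (cvg_dotr muF); apply: cvgB yF; exact: cvg_cst.
  have zn : \forall p \near F, gapb z < dotr p.2 (z - p.1.1.2).
    exact: (cvgr_gt _ zF _ zP).
  apply: filterS zn => p zp [_ /(_ z z_dom)].
  by rewrite leNgt zp.
move=> [[A E] [[[/= B C] [/near_norm_ltP[r1 r10 Br] /near_norm_ltP[r2 r20 Cr]]] BC]
  /near_norm_ltP[r3 r30 Er] AE].
pose d := Num.min (Num.min r1 r2) (2^-1 * r3).
have d0 : 0 < d by rewrite !lt_min r10 r20 mulr_gt0.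
exists d => // x y l; rewrite !lt_min => /andP[/andP[x1 _] _] /andP[/andP[_ y2] _].
move=> /andP[_ l3] lsub; rewrite ltNge; apply/negP => el.
have l0 : 0 < `|l - lb| by exact: lt_le_trans el.
pose s := e / `|l - lb|.
have s0 : 0 < s by rewrite divr_gt0.
have s1 : s <= 1 by rewrite ler_pdivrMr// mul1r.
have := AE ((x, y), 2^-1 * r3) _ (s *: (l - lb)); apply.
- split => /=; first by apply: BC; split => /=; [exact: Br|exact: Cr].
  by apply: Er; rewrite subr0 gtr0_norm ?mulr_gt0//; lra.
- by rewrite normrZ gtr0_norm// divfK ?gt_eqF.
- split => /=.
    rewrite -scalemxAl normrZ gtr0_norm//.
    have -> : (l - lb) *m ('J f x)^T = grad_lagrangian phi0 f x l - g x.
      by rewrite (grad_lagrangianE _ _ lb) -/(g x) [g x + _]addrC addrK.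
    apply: le_trans (_ : `|grad_lagrangian phi0 f x l - g x| <= _).
      exact: ler_piMl.
    by apply: le_trans (ler_normB _ _) _; rewrite lerD2r ltW.
  move=> z z_dom.
  have /(subdifferentialP ybar lb theta_gtNy)[y_dom /(_ z z_dom)] := lsub.
  have := gap_ge0 theta_gtNy lb_sub y_dom; have := gap_ge0 theta_gtNy lb_sub z_dom.
  by rewrite dotrZl; nra.
Qed.

(** An augmented Lagrangian in the pair [(x, y)], where [y] stands for [f x] and
  the equality is penalized, with quadratic perturbations: the term in [eta]
  compensates a possible lack of strict minimality at [xbar], and the one in [M]
  localizes around a test point [(a, b)]. *)
Definition penalized (rho eta M : R) (a : 'rV[R]_n) (b : 'rV[R]_m)
    (p : 'rV[R]_n * 'rV[R]_m) : R :=
  ell p.1 + 2^-1 * rho * dotr (f p.1 - p.2) (f p.1 - p.2)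
  + eta * dotr (p.1 - xbar) (p.1 - xbar)
  + M * (dotr (p.1 - a) (p.1 - a) + dotr (p.2 - b) (p.2 - b)) + gapb p.2.

(** A local minimizer of the penalized function solves a perturbed generalized
  equation; the chain rule only involves smooth functions. *)
Lemma penalized_stationary rho eta M a b x y :
  (forall w, is_derive x w f (w *m 'J f x)) ->
  (forall w, is_derive x w ell (dotr (g x) w)) ->
  edom theta y ->
  (\forall p \near (x, y), edom theta p.2 ->
     penalized rho eta M a b (x, y) <= penalized rho eta M a b p) ->
  let l := lb + rho *: (f x - y) - (2 * M) *: (y - b) in
  subdifferential theta y l /\
  grad_lagrangian phi0 f x l = - ((2 * eta) *: (x - xbar) + (2 * M) *: (x - a)
    + (2 * M) *: (y - b) *m ('J f x)^T).
Proof.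
move=> df dell y_dom pmin l.
have lE : l - lb = rho *: (f x - y) - (2 * M) *: (y - b).
  by rewrite /l addrAC [lb + _]addrC addrK.
split.
  apply/(subdifferentialP ybar lb theta_gtNy); split=> // z z_dom.
  rewrite lE -subr_ge0.
  apply: (@le0_affine_near _ _ ((2^-1 * rho + M) * dotr (z - y) (z - y))).
  have tyF : (fun t : R => (x, y + t *: (z - y))) @ (0 : R)^'+ --> (x, y).
    have cF : (fun=> x) @ (0 : R)^'+ --> x by exact: cvg_cst.
    have yF : (fun t : R => y + t *: (z - y)) @ (0 : R)^'+ --> y by exact: cvg_ray.
    exact: (cvg_pair cF yF).
  have pt := tyF _ pmin; near=> t.
  have t0 : 0 < t by [].
  have t01 : 0 < t < 1 by apply/andP; split.
  have [t_dom tgap] := gap_convex ybar lb theta_gtNy theta_convex z_dom y_dom t01.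
  have tE : t *: z + (1 - t) *: y = y + t *: (z - y).
    by rewrite scalerBl scale1r scalerBr addrCA.
  rewrite tE in t_dom tgap.
  have : penalized rho eta M a b (x, y) <=
      penalized rho eta M a b (x, y + t *: (z - y)).
    by move: t_dom; near: t.
  rewrite /penalized /= !dotr_lin => H0.
  rewrite -(pmulr_rge0 _ t0); move: H0 tgap.
  rewrite (dotrC y (f x)) (dotrC z (f x)) (dotrC z y) (dotrC b y) (dotrC b z); lra.
pose v := g x + rho *: ((f x - y) *m ('J f x)^T) + (2 * eta) *: (x - xbar)
  + (2 * M) *: (x - a).
have v_ge0 w : 0 <= dotr v w.
  pose F t := t^-1 *: (f (x + t *: w) - f x).
  pose Q t := t^-1 * (ell (x + t *: w) - ell x)
    + 2^-1 * rho * (t * dotr (F t) (F t) + 2 * dotr (F t) (f x - y))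
    + eta * (2 * dotr w (x - xbar) + t * dotr w w)
    + M * (2 * dotr w (x - a) + t * dotr w w).
  have tF : (fun t : R => t) @ (0 : R)^'+ --> (0 : R) by exact: cvg_within.
  have cF (T : topologicalType) (z : T) : (fun=> z) @ (0 : R)^'+ --> z.
    exact: cvg_cst.
  have FF : F @ (0 : R)^'+ --> w *m 'J f x by exact: (cvg_right_derive (df w)).
  have eF : (fun t => t^-1 * (ell (x + t *: w) - ell x)) @ (0 : R)^'+ --> dotr (g x) w.
    exact: (cvg_right_derive (dell w)).
  have polyF (c1 c2 c3 : R) : (fun t => c1 * (c2 + t * c3)) @ (0 : R)^'+ -->
      c1 * (c2 + 0 * c3).
    exact: (cvgM (cF _ c1) (cvgD (cF _ c2) (cvgM tF (cF _ c3)))).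
  have QF : Q @ (0 : R)^'+ --> dotr (g x) w
      + 2^-1 * rho * (0 * dotr (w *m 'J f x) (w *m 'J f x)
                      + 2 * dotr (w *m 'J f x) (f x - y))
      + eta * (2 * dotr w (x - xbar) + 0 * dotr w w)
      + M * (2 * dotr w (x - a) + 0 * dotr w w).
    apply: (cvgD (cvgD (cvgD eF _) (polyF _ _ _)) (polyF _ _ _)).
    apply: (cvgM (cF _ _) (cvgD (cvgM tF (cvg_dotr FF FF)) _)).
    exact: (cvgM (cF _ _) (cvg_dotr FF (cF _ _))).
  have -> : dotr v w = dotr (g x) w
      + 2^-1 * rho * (0 * dotr (w *m 'J f x) (w *m 'J f x)
                      + 2 * dotr (w *m 'J f x) (f x - y))
      + eta * (2 * dotr w (x - xbar) + 0 * dotr w w)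
      + M * (2 * dotr w (x - a) + 0 * dotr w w).
    have JE : dotr ((f x - y) *m ('J f x)^T) w = dotr (w *m 'J f x) (f x - y).
      by rewrite dotr_mulmx trmxK dotrC.
    rewrite /v 3!dotrDl 3!dotrZl JE (dotrC (x - xbar)) (dotrC (x - a)).
    by field.
  apply: le_cvg (cF _ 0) QF _.
  have xF : (fun t : R => (x + t *: w, y)) @ (0 : R)^'+ --> (x, y).
    have x1F : (fun t : R => x + t *: w) @ (0 : R)^'+ --> x by exact: cvg_ray.
    exact: (cvg_pair x1F (cF _ y)).
  have pt := xF _ pmin; near=> t.
  have t0 : 0 < t by [].
  have : penalized rho eta M a b (x, y) <= penalized rho eta M a b (x + t *: w, y).
    by move: y_dom; near: t.
  have fE : f (x + t *: w) = f x + t *: F t.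
    by rewrite /F scalerA mulfV ?gt_eqF// scale1r [f x + _]addrC subrK.
  rewrite /penalized /= fE -(pmulr_rge0 _ t0) => H0.
  have -> : t * Q t = ell (x + t *: w) - ell x
    + 2^-1 * rho * (t * (t * dotr (F t) (F t) + 2 * dotr (F t) (f x - y)))
    + eta * (t * (2 * dotr w (x - xbar) + t * dotr w w))
    + M * (t * (2 * dotr w (x - a) + t * dotr w w)).
    by rewrite /Q; field; rewrite gt_eqF.
  move: H0; rewrite -[f x + _ - y]addrAC -[x + _ - xbar]addrAC -[x + _ - a]addrAC.
  move: (f x - y) (x - xbar) (x - a) (F t) => u1 u2 u3 Ft.
  rewrite !dotr_lin (dotrC u1 Ft) (dotrC u2 w) (dotrC u3 w); lra.
have v0 : v = 0.
  by apply: dotr_eq0; apply/le_anti; rewrite dotr_ge0 andbT -oppr_ge0 -dotrNr.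
rewrite (grad_lagrangianE _ _ lb) -/(g x) lE mulmxBl -!scalemxAl.
apply/eqP; rewrite -subr_eq0 opprK -v0 /v; apply/eqP.
move: (g x) => gx; move: ((f x - y) *m _) ((y - b) *m _) => u1 u2.
by rewrite [LHS]addrACA subrK -!addrA; congr (_ + _); rewrite [LHS]addrA [LHS]addrC.
Unshelve. all: by end_near. Qed.

Lemma smooth_near : \forall x \near xbar,
  [/\ forall w, is_derive x w f (w *m 'J f x),
      forall w, is_derive x w ell (dotr (g x) w),
      f @ x --> f x & ell @ x --> ell x].
Proof.
apply: filterS3 (lagrangian_is_derive lb phi0_C2 f_C2) f_C2 phi0_C2.
move=> x dell [df _ _] [dphi _ _]; have fx := differentiable_continuous df.
split=> //.
  move=> w; apply: DeriveDef; first exact: diff_derivable.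
  exact: deriveEjacobian.
have cl : (fun=> lb) @ nbhs x --> lb by exact: cvg_cst.
exact: (cvgD (differentiable_continuous dphi) (cvg_dotr cl fx)).
Qed.

(** Only the gap may be discontinuous, and it is lower semicontinuous. *)
Lemma penalized_lsc rho eta M a b p c :
  f @ p.1 --> f p.1 -> ell @ p.1 --> ell p.1 ->
  (edom theta p.2 -> c < penalized rho eta M a b p) ->
  \forall q \near p, edom theta q.2 -> c < penalized rho eta M a b q.
Proof.
move=> fp ellp cp.
pose S (q : 'rV[R]_n * 'rV[R]_m) : R :=
  ell q.1 + 2^-1 * rho * dotr (f q.1 - q.2) (f q.1 - q.2)
  + eta * dotr (q.1 - xbar) (q.1 - xbar)
  + M * (dotr (q.1 - a) (q.1 - a) + dotr (q.2 - b) (q.2 - b)).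
have penE q : penalized rho eta M a b q = S q + gapb q.2 by [].
have x1 : (fun q : 'rV[R]_n * 'rV[R]_m => q.1) @ nbhs p --> p.1 by exact: cvg_fst.
have y1 : (fun q : 'rV[R]_n * 'rV[R]_m => q.2) @ nbhs p --> p.2 by exact: cvg_snd.
have cF (T : topologicalType) (z : T) : (fun=> z) @ nbhs p --> z by exact: cvg_cst.
have sq k (u : 'rV[R]_n * 'rV[R]_m -> 'rV[R]_k) v : u @ nbhs p --> v ->
    (fun q => dotr (u q) (u q)) @ nbhs p --> dotr v v.
  by move=> uv; exact: (cvg_dotr uv uv).
have fF : (fun q : 'rV[R]_n * 'rV[R]_m => f q.1) @ nbhs p --> f p.1.
  exact: (cvg_comp _ _ x1 fp).
have eF : (fun q : 'rV[R]_n * 'rV[R]_m => ell q.1) @ nbhs p --> ell p.1.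
  exact: (cvg_comp _ _ x1 ellp).
have SF : S @ nbhs p --> S p.
  apply: (cvgD (cvgD (cvgD eF _) _) _).
  - exact: (cvgM (cF _ _) (sq _ _ _ (cvgB fF y1))).
  - exact: (cvgM (cF _ _) (sq _ _ _ (cvgB x1 (cF _ _)))).
  - apply: (cvgM (cF _ _) (cvgD (sq _ _ _ (cvgB x1 (cF _ _))) _)).
    exact: (sq _ _ _ (cvgB y1 (cF _ _))).
have [e [e0 ep]] : exists e, 0 < e /\ (edom theta p.2 -> c - S p + e < gapb p.2).
  have [p_dom|np] := pselect (edom theta p.2); last by exists 1.
  exists (2^-1 * (S p + gapb p.2 - c)); have := cp p_dom; rewrite penE => ?.
  by split=> [|_]; lra.
have Sn : \forall q \near p, S p - e < S q.
  by apply: (cvgr_gt _ SF); rewrite ltrBlDr ltrDl.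
have gn : \forall q \near p, edom theta q.2 -> c - S p + e < gapb q.2.
  exact: (y1 _ (gap_lsc theta_plq ep)).
apply: filterS2 Sn gn => q Sq gq q_dom; rewrite penE.
by have := gq q_dom; move: Sq; move: (S q) (S p) => *; lra.
Qed.

Lemma penalized_min_exists r rho eta M a b : 0 <= r ->
  (forall x, `|x - xbar| <= r -> f @ x --> f x /\ ell @ x --> ell x) ->
  exists p, [/\ `|p.1 - xbar| <= r, `|p.2 - ybar| <= r, edom theta p.2 &
    forall x y, `|x - xbar| <= r -> `|y - ybar| <= r -> edom theta y ->
      penalized rho eta M a b p <= penalized rho eta M a b (x, y)].
Proof.
move=> r0 cont.
pose K := [set x : 'rV[R]_n | `|x - xbar| <= r] `*` [set y : 'rV[R]_m | `|y - ybar| <= r].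
have [|||p [[/= px py] p_dom pmin]] :=
    @compact_lsc_min R _ K [set p | edom theta p.2] (penalized rho eta M a b).
- by apply: compact_setX; exact: closed_ball_compact.
- by exists (xbar, ybar); split; [split; rewrite /= subrr normr0|].
- move=> p c [/= px _] cp; have [fp ellp] := cont _ px; exact: penalized_lsc.
by exists p; split=> // x y xr yr y_dom; exact: pmin.
Qed.

Lemma penalized_base rho eta : penalized rho eta 0 0 0 (xbar, ybar) = ell xbar.
Proof. by rewrite /penalized /= gap_base !subrr !dotr0r !mulr0 mul0r !addr0. Qed.

Lemma subregular_residual :
  strongly_metrically_subregular (KKT_mapping phi0 theta f) (xbar, lb) (0, 0) ->
  exists kappa e : R, [/\ 0 < kappa, 0 < e & forall x y l,
    `|x - xbar| < e -> `|l - lb| < e -> subdifferential theta y l ->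
    `|(x - xbar, l - lb)| <= kappa * `|(grad_lagrangian phi0 f x l, y - f x)|].
Proof.
move=> [_ [kappa kappa0 /near_norm_ltP[e e0 sub]]]; exists (kappa + 1), e.
split=> // [|x y l xe le lsub]; first by rewrite ltr_wpDl.
have : `|(x, l) - (xbar, lb)| < e by rewrite prod_normE gt_max xe.
move=> /sub; set E := edist_set _ _ => kE.
have Er : (E <= `|(grad_lagrangian phi0 f x l, y - f x)|%:E)%E.
  apply: ge_ereal_inf; exists `|(0, 0) - (grad_lagrangian phi0 f x l, - f x + y)|%:E.
    by exists (grad_lagrangian phi0 f x l, - f x + y) => //; exists y.
  by rewrite lee_fin -normrN opprB subr0 [- f x + y]addrC.
have k0 : (0 <= kappa%:E)%E by rewrite lee_fin.
have := le_trans kE (lee_wpmul2l k0 Er); rewrite -EFinM lee_fin => /le_trans; apply.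
by rewrite mulrDl lerDl mul1r.
Qed.

Lemma penalized_monotone rho rho' eta M a b p : rho <= rho' ->
  penalized rho eta M a b p <= penalized rho' eta M a b p.
Proof.
move=> le_rho; rewrite /penalized !lerD2r lerD2l ler_wpM2r ?dotr_ge0//.
by rewrite ler_pM2l// invr_gt0.
Qed.

(** For a large penalty, the minimizers of the penalized function on a fixed
  ball are close to [(xbar, ybar)]; their stationarity conditions are a
  perturbed generalized equation whose residuals are small multiples of the
  distance to [(xbar, lb)], so that subregularity leaves only [(xbar, ybar)]. *)
Lemma exact_penalty :
  strongly_metrically_subregular (KKT_mapping phi0 theta f) (xbar, lb) (0, 0) ->
  local_minimizer phi0 theta f xbar ->
  exists2 eta0 : R, 0 < eta0 & forall eta, 0 < eta -> eta < eta0 ->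
  exists rho r : R, [/\ 0 < rho, 0 < r & forall x y,
    `|x - xbar| <= r -> `|y - ybar| <= r -> edom theta y ->
    ell xbar <= penalized rho eta 0 0 0 (x, y)].
Proof.
move=> subr /(local_minimizerP phi0 theta_gtNy lb_sub) locmin.
have [kappa [e [kappa0 e0 res]]] := subregular_residual subr.
have [d d0 stab] := multiplier_stability (subregular_unique_multiplier subr) e0.
have /near_norm_ltP[r1 r10 reg] : \forall x \near xbar,
    [/\ forall w, is_derive x w f (w *m 'J f x),
        forall w, is_derive x w ell (dotr (g x) w),
        f @ x --> f x & ell @ x --> ell x] /\
    (edom theta (f x) -> ell xbar <= ell x + gapb (f x)).
  exact: filterI smooth_near locmin.
pose r := 2^-1 * r1; have r0 : 0 < r by rewrite mulr_gt0// invr_gt0.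
have rr1 : r < r1 by rewrite /r; lra.
pose d' := Num.min d (Num.min e r).
have d'0 : 0 < d' by rewrite !lt_min d0 e0 r0.
exists (Num.min 2^-1 (2 * kappa)^-1).
  by rewrite lt_min !invr_gt0 mulr_gt0// ltr0n.
move=> eta eta0; rewrite lt_min => /andP[eta1 eta2].
have etak : 2 * eta * kappa < 1.
  by move: eta2; rewrite -[(2 * kappa)^-1]mul1r ltr_pdivlMr ?mulr_gt0//; lra.
pose K := [set x : 'rV[R]_n | `|x - xbar| <= r] `*` [set y : 'rV[R]_m | `|y - ybar| <= r].
pose U (p : 'rV[R]_n * 'rV[R]_m) := `|p.1 - xbar| < d' /\ `|p.2 - ybar| < d'.
pose P rho p := U p \/ (edom theta p.2 -> ell xbar < penalized rho eta 0 0 0 p).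
have : \forall rho \near +oo, forall p, K p -> P rho p.
  apply: compact_eventually; first by apply: compact_setX; exact: closed_ball_compact.
  move=> p [/= px py].
  have [[_ _ fp ellp] lmin] := reg p.1 (le_lt_trans px rr1).
  have [[Ux Uy]|nU] := pselect (U p).
    exists (setT, U); first split=> /=; first exact: filterT.
      have x1 : (fun q : 'rV[R]_n * 'rV[R]_m => q.1) @ nbhs p --> p.1 by exact: cvg_fst.
      have y1 : (fun q : 'rV[R]_n * 'rV[R]_m => q.2) @ nbhs p --> p.2 by exact: cvg_snd.
      have xn : \forall x \near p.1, `|x - xbar| < d' by exact: near_norm_lt_open.
      have yn : \forall y \near p.2, `|y - ybar| < d' by exact: near_norm_lt_open.
      have xn' : \forall q \near p, `|q.1 - xbar| < d' by exact: (x1 _ xn).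
      have yn' : \forall q \near p, `|q.2 - ybar| < d' by exact: (y1 _ yn).
      exact: filterI xn' yn'.
    by move=> [rho q] [/= _ Uq]; left.
  have [rho1 rho1P] : exists rho1,
      edom theta p.2 -> ell xbar < penalized rho1 eta 0 0 0 p.
    have [fpE|fpE] := eqVneq (f p.1) p.2.
      exists 0 => p_dom; have := lmin; rewrite fpE => /(_ p_dom) lminp.
      have px0 : p.1 - xbar != 0.
        apply/eqP => px0; apply: nU.
        have pE : p.1 = xbar by apply/eqP; rewrite -subr_eq0 px0.
        by split; rewrite ?px0 -?fpE ?pE ?subrr normr0.
      have := mulr_gt0 eta0 (dotr_gt0 px0).
      by rewrite /penalized fpE; lra.
    pose c := dotr (f p.1 - p.2) (f p.1 - p.2).
    have c0 : 0 < c by apply: dotr_gt0; rewrite subr_eq0.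
    exists (2 * (`|ell xbar - ell p.1| + 1) / c) => p_dom.
    have := gap_ge0 theta_gtNy lb_sub p_dom.
    have := mulr_ge0 (ltW eta0) (dotr_ge0 (p.1 - xbar)).
    rewrite /penalized -/c => h1 h2.
    have half (u v : R) : 0 < v -> 2^-1 * (2 * u / v) * v = u.
      by move=> v0; field; exact: lt0r_neq0.
    rewrite half//.
    by have := ler_norm (ell xbar - ell p.1); lra.
  exists ([set rho | rho1 <= rho],
    [set q | edom theta q.2 -> ell xbar < penalized rho1 eta 0 0 0 q]).
    split=> /=; last exact: penalized_lsc.
    exact: (nbhs_pinfty_ge (num_real rho1)).
  move=> [rho q] [/= rho1q qP]; right => q_dom.
  exact: lt_le_trans (qP q_dom) (penalized_monotone _ _ _ _ _ rho1q).
move=> rhoP.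
have [rho [rhok KP]] : exists rho, kappa < rho /\ forall p, K p -> P rho p.
  apply: (@filter_ex _ (pinfty_nbhs R)); apply: filterI rhoP.
  exact: (nbhs_pinfty_gt (num_real kappa)).
have rho0 : 0 < rho by exact: lt_trans rhok.
exists rho, r; split=> //.
have cont x : `|x - xbar| <= r -> f @ x --> f x /\ ell @ x --> ell x.
  by move=> xr; have [[_ _ fx ellx] _] := reg x (le_lt_trans xr rr1).
have [[x y] [/= xr yr y_dom pmin]] := penalized_min_exists rho eta 0 0 0 (ltW r0) cont.
have pbar : penalized rho eta 0 0 0 (x, y) <= ell xbar.
  rewrite -(penalized_base rho eta); apply: pmin => //; by rewrite subrr normr0 ltW.
have [[/= Ux Uy]|/(_ y_dom)] := KP (x, y) (conj xr yr); last by rewrite ltNge pbar.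
suff [xE yE] : x = xbar /\ y = ybar.
  move: pmin; rewrite xE yE (penalized_base rho eta) => pmin x' y' xr' yr' y'_dom.
  exact: pmin.
have [[dfx dellx _ _] _] := reg x (le_lt_trans xr rr1).
move: Ux Uy; rewrite !lt_min => /andP[xd /andP[xe xr']] /andP[yd /andP[ye yr']].
have pnear : \forall q \near (x, y), edom theta q.2 ->
    penalized rho eta 0 0 0 (x, y) <= penalized rho eta 0 0 0 q.
  have x1 : (fun q : 'rV[R]_n * 'rV[R]_m => q.1) @ nbhs (x, y) --> x by exact: cvg_fst.
  have y1 : (fun q : 'rV[R]_n * 'rV[R]_m => q.2) @ nbhs (x, y) --> y by exact: cvg_snd.
  have xn : \forall q \near (x, y), `|q.1 - xbar| < r.
    exact: (x1 _ (near_norm_lt_open xr')).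
  have yn : \forall q \near (x, y), `|q.2 - ybar| < r.
    exact: (y1 _ (near_norm_lt_open yr')).
  apply: filterS2 xn yn => -[x' y'] /= x'r y'r y'_dom.
  by apply: pmin => //; exact: ltW.
have [] := penalized_stationary dfx dellx y_dom pnear.
rewrite mulr0 !scale0r mul0mx subr0 !addr0; set l := lb + _ => lsub lgrad.
have llb : l - lb = rho *: (f x - y) by rewrite /l [lb + _]addrC addrK.
have grad_norm : `|grad_lagrangian phi0 f x l| = 2 * eta * `|x - xbar|.
  by rewrite lgrad normrN normrZ gtr0_norm// mulr_gt0.
have le : `|l - lb| < e.
  apply: (stab x y l) => //; rewrite grad_norm; apply: le_lt_trans xd.
  by rewrite ler_piMl//; lra.
have := res x y l xe le lsub.
set mm := `|(x - xbar, l - lb)|.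
have [Am Bm] : `|x - xbar| <= mm /\ `|l - lb| <= mm.
  by apply/andP; rewrite -(pair_norm_le (x - xbar, l - lb)).
have mm0 : 0 <= mm by exact: normr_ge0.
have yfx : rho * `|y - f x| = `|l - lb|.
  by rewrite llb normrZ gtr0_norm// distrC.
have krho : kappa * `|y - f x| <= kappa / rho * mm.
  rewrite -mulrA ler_pM2l// ler_pdivlMl// yfx; exact: Bm.
rewrite prod_normE /= grad_norm maxr_pMr ?(ltW kappa0)// => mle.
have contract th : th < 1 -> mm <= th * mm -> mm <= 0.
  move=> th1 mth; rewrite -(pmulr_rle0 _ (_ : 0 < 1 - th)) ?subr_gt0//.
  by rewrite mulrBl mul1r subr_le0.
have mE : mm = 0.
  apply/le_anti; rewrite mm0 andbT; move: mle; rewrite le_max => /orP[mle|mle].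
    apply: contract etak _; apply: le_trans mle _.
    rewrite mulrA [kappa * _]mulrC ler_pM2l ?Am// !mulr_gt0//.
  by apply: contract (le_trans mle krho); rewrite ltr_pdivrMr// mul1r.
have xE : x = xbar.
  by apply/eqP; rewrite -subr_eq0 -normr_le0 -mE.
split=> //; apply/eqP; rewrite /ybar -[X in f X]xE -subr_eq0 -normr_le0.
by rewrite -(pmulr_rle0 _ rho0) yfx -mE.
Qed.

Lemma jacobian_bound : exists2 C : R, 0 <= C & \forall x \near xbar,
  (forall v : 'rV[R]_m, `|v *m ('J f x)^T| <= C * `|v|) /\
  (forall v : 'rV[R]_n, `|v *m J| <= C * `|v|).
Proof.
exists (m%:R * (`|J^T| + 1) + n%:R * `|J|); first by rewrite addr_ge0 ?mulr_ge0 ?addr_ge0.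
have JF : (fun x => `|('J f x)^T|) @ nbhs xbar --> `|J^T|.
  exact: (cvg_norm (cvg_trmx (jacobian_cvg f_C2))).
have Jn : \forall x \near xbar, `|('J f x)^T| < `|J^T| + 1.
  by apply: (cvgr_lt _ JF); rewrite ltrDl.
apply: filterS Jn => x Jx; split=> v; apply: le_trans (mulmx_norm_le _ _) _.
  rewrite mulrA ler_wpM2r// (@le_trans _ _ (m%:R * (`|J^T| + 1)))//.
    by rewrite ler_wpM2l// ltW.
  by rewrite lerDl mulr_ge0.
by rewrite mulrA ler_wpM2r// lerDr mulr_ge0 ?addr_ge0.
Qed.

(** At [(a, b)] the localizing terms vanish and the terms in [q] of [ell] and of
  the gap cancel; the four remaining errors, from [ell], the gap, the penalty and
  the term in [eta], are [1/8], [1/8], [1/4] and [1/2] of [sigma^2 t^2]. *)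
Lemma penalized_test_point rho eta sigma e2 q t (w : 'rV[R]_n) (w' : 'rV[R]_m) :
  0 <= rho -> 0 <= e2 -> e2 <= 1 -> 8 * rho * (m%:R + 1) * e2 <= sigma ^+ 2 ->
  eta * dotr w w = sigma ^+ 2 / 2 -> 0 < t ->
  let a := xbar + t *: w in let b := ybar + t *: w' in
  ell a <= ell xbar + 2^-1 * t ^+ 2 * q + t ^+ 2 * (sigma ^+ 2 / 8) ->
  `|f a - b| <= 2 * e2 * t ->
  gapb b <= 2^-1 * t ^+ 2 * (- q + sigma ^+ 2 / 4) ->
  penalized rho eta 1 a b (a, b) <= ell xbar + sigma ^+ 2 * t ^+ 2.
Proof.
move=> rho0 e20 e21 e2s etaw t0 a b ella fab gapab.
rewrite /penalized /= [a - a]subrr [b - b]subrr !dotr0r addr0 mulr0 addr0.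
have -> : a - xbar = t *: w by rewrite /a [xbar + _]addrC addrK.
have Nfab : dotr (f a - b) (f a - b) <= m%:R * (4 * e2 * t ^+ 2).
  apply: le_trans (ler_norm _) (le_trans (dotr_norm_le _ _) _).
  rewrite ler_wpM2l// -expr2.
  apply: (@le_trans _ _ ((2 * e2 * t) ^+ 2)).
    by rewrite lerXn2r ?nnegrE// !mulr_ge0// ltW.
  have -> : (2 * e2 * t) ^+ 2 = 4 * t ^+ 2 * (e2 * e2) by ring.
  have -> : 4 * e2 * t ^+ 2 = 4 * t ^+ 2 * e2 by ring.
  apply: ler_wpM2l; last exact: ler_piMl.
  by rewrite mulr_ge0 ?sqr_ge0.
have rhoN : 2^-1 * rho * dotr (f a - b) (f a - b) <= t ^+ 2 * (sigma ^+ 2 / 4).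
  apply: (@le_trans _ _ (2^-1 * rho * (m%:R * (4 * e2 * t ^+ 2)))).
    by rewrite ler_wpM2l// mulr_ge0.
  have -> : 2^-1 * rho * (m%:R * (4 * e2 * t ^+ 2)) = t ^+ 2 * (2 * rho * m%:R * e2).
    by field.
  rewrite ler_wpM2l ?sqr_ge0//.
  have re0 : 0 <= rho * e2 by exact: mulr_ge0.
  by move: e2s; move: (m%:R : R) => mm; lra.
have -> : eta * dotr (t *: w) (t *: w) = t ^+ 2 * (sigma ^+ 2 / 2).
  by rewrite dotrZl dotrZr -etaw; ring.
lra.
Qed.

(** If the second-order condition failed in direction [w], the perturbed
  penalized problem would have minimizers near [xbar + t w], at a distance
  comparable to [t] from [xbar], solving the generalized equation with residuals
  of order [sigma t] for an arbitrarily small [sigma]. *)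
Lemma subregular_sosc :
  strongly_metrically_subregular (KKT_mapping phi0 theta f) (xbar, lb) (0, 0) ->
  local_minimizer phi0 theta f xbar ->
  second_order_sufficient phi0 theta f xbar lb.
Proof.
move=> subr locmin; apply/(second_order_sufficientP phi0 theta_gtNy lb_sub).
move=> w w0 a0 Da0; rewrite ltNge; apply/negP => a0q.
pose q := dotr (w *m H) w.
have Dq : (second_subderivative theta ybar lb (w *m J) <= (- q)%:E)%E.
  by apply: le_trans Da0 _; rewrite lee_fin; move: a0q; rewrite -/H -/q; lra.
have [kappa [e [kappa0 e0 res]]] := subregular_residual subr.
have [eta0 eta00 pen] := exact_penalty subr locmin.
have [C C0 CJ] := jacobian_bound.
pose Nw := dotr w w; have Nw0 : 0 < Nw by exact: dotr_gt0.
pose nw := `|w|; have nw0 : 0 < nw by rewrite normr_gt0.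
(* [K sigma t] will bound both residuals at the minimizer. *)
pose K := (nw + 1) / Nw + 2 * C + 6.
have K1 : 0 <= (nw + 1) / Nw by rewrite divr_ge0 ?addr_ge0 ?ltW.
have K0 : 0 < K by rewrite /K; lra.
have [sigma [s0 s1 s2 [s3 s4]]] : exists sigma : R, [/\ 0 < sigma, sigma <= 1,
    sigma <= nw / 2 & kappa * K * sigma < nw / 2 /\ sigma < 2 * Nw * eta0].
  near (0 : R)^'+ => sigma; exists sigma; split=> //.
  - by near: sigma; exact: nbhs_right_le.
  - by near: sigma; apply: nbhs_right_le; rewrite divr_gt0.
  split; last by near: sigma; apply: nbhs_right_lt; rewrite !mulr_gt0.
  rewrite mulrC -ltr_pdivlMr ?mulr_gt0//.
  by near: sigma; apply: nbhs_right_lt; rewrite !divr_gt0// mulr_gt0.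
(* The term in [eta] then adds [sigma^2 t^2 / 2] at the test point [xbar + t w],
  which leaves the order of the localizing terms [sigma^2 t^2] unchanged. *)
pose eta := sigma ^+ 2 / (2 * Nw).
have eta_gt0 : 0 < eta by rewrite divr_gt0 ?exprn_gt0 ?mulr_gt0.
have ss : sigma ^+ 2 <= sigma by rewrite expr2 ler_piMl// ltW.
have eta_lt : eta < eta0.
  by rewrite ltr_pdivrMr ?mulr_gt0// mulrC; exact: le_lt_trans s4.
have etaE : eta * Nw = sigma ^+ 2 / 2.
  by rewrite /eta; field; exact: lt0r_neq0.
have [rho [r [rho0 r0 pen_ge]]] := pen eta eta_gt0 eta_lt.
(* The penalty parameter [rho] may be huge: the test point has to satisfy the
  constraint up to [e2 t] with [e2] small compared with [sigma^2 / rho]. *)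
have [e2 [e20 e21 e2s e2m]] : exists e2 : R, [/\ 0 < e2, e2 <= 1, e2 <= sigma &
    8 * rho * (m%:R + 1) * e2 <= sigma ^+ 2].
  have c0 : 0 < 8 * rho * (m%:R + 1) by rewrite !mulr_gt0// ltr_wpDl.
  near (0 : R)^'+ => e2; exists e2; split=> //.
  - by near: e2; exact: nbhs_right_le.
  - by near: e2; exact: nbhs_right_le.
  rewrite mulrC -ler_pdivlMr//.
  by near: e2; apply: nbhs_right_le; rewrite divr_gt0// exprn_gt0.
have e1' : 0 < sigma ^+ 2 / 8 / nw ^+ 2 by rewrite !divr_gt0 ?exprn_gt0.
have e2' : 0 < e2 / (nw + 1) by rewrite divr_gt0// addr_gt0.
have [r1 r10 reg] : exists2 r1 : R, 0 < r1 & forall x, `|x - xbar| < r1 ->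
   [/\ [/\ forall w, is_derive x w f (w *m 'J f x),
        forall w, is_derive x w ell (dotr (g x) w),
        f @ x --> f x & ell @ x --> ell x],
     (forall v : 'rV[R]_m, `|v *m ('J f x)^T| <= C * `|v|) /\
       (forall v : 'rV[R]_n, `|v *m J| <= C * `|v|),
     `|ell x - ell xbar - 2^-1 * dotr ((x - xbar) *m H) (x - xbar)|
        <= sigma ^+ 2 / 8 / nw ^+ 2 * `|x - xbar| ^+ 2 &
     `|f x - f xbar - (x - xbar) *m 'J f xbar| <= e2 / (nw + 1) * `|x - xbar|].
  apply/near_norm_ltP; apply: filterS2 (filterI smooth_near CJ) (filterI
   (lagrangian_expansion phi0_C2 f_C2 stationary e1') (constraint_expansion f_C2 e2')).
  by move=> x [? ?] [? ?].
pose r' := Num.min r (r1 / 2).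
have r'0 : 0 < r' by rewrite lt_min r0 divr_gt0.
have r'r1 : r' < r1 by rewrite gt_min orbC; apply/orP; left; lra.
pose wJ := `|w *m J|; have wJ0 : 0 <= wJ by exact: normr_ge0.
have rhoK : 0 < rho * K + 2 by rewrite addr_gt0// mulr_gt0.
have nw1 : 0 < nw + 1 by rewrite addr_gt0.
have wJ2 : 0 < wJ + 2 by rewrite ltr_wpDl.
have tpos : \forall t \near (0 : R)^'+,
    [/\ t * (nw + 1) < r1, t * (nw + 1) < r', t * (nw + 1) < e,
        t * (wJ + 2) < r' & t * (rho * K + 2) < e].
  have small (c d : R) : 0 < c -> 0 < d -> \forall t \near (0 : R)^'+, t * c < d.
    move=> c0 d0; near=> t; rewrite -ltr_pdivlMr//.
    by near: t; apply: nbhs_right_lt; rewrite divr_gt0.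
  near=> t; split; near: t; exact: small.
have FV : filter_prod (0 : R)^'+ (nbhs (w *m J)) [set p |
    [/\ p.1 * (nw + 1) < r1, p.1 * (nw + 1) < r', p.1 * (nw + 1) < e,
        p.1 * (wJ + 2) < r' & p.1 * (rho * K + 2) < e] /\ `|p.2 - w *m J| < e2].
  exact: (filterI (near_fst tpos) (near_snd (near_norm_lt (w *m J) e20))).
have s24 : 0 < sigma ^+ 2 / 4 by rewrite divr_gt0 ?exprn_gt0.
have [[t w'] [/= [[t1 t2 t3 t4 t5] w'e] t0 b_dom gapb_le]] :=
  second_subderivative_frequently theta_gtNy lb_sub s24 Dq FV.
pose a := xbar + t *: w; pose b := ybar + t *: w'.
have axE : a - xbar = t *: w by rewrite /a [xbar + _]addrC addrK.
have byE : b - ybar = t *: w' by rewrite /b [ybar + _]addrC addrK.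
have ax : `|a - xbar| = t * nw by rewrite axE normrZ gtr0_norm.
have tnw : t * nw <= t * (nw + 1) by rewrite ler_pM2l// lerDl.
have ar1 : `|a - xbar| < r1 by rewrite ax (le_lt_trans tnw).
have [_ _ ella fa] := reg a ar1.
have ell_a : ell a <= ell xbar + 2^-1 * t ^+ 2 * q + t ^+ 2 * (sigma ^+ 2 / 8).
  have := le_trans (ler_norm _) ella; rewrite ax axE -scalemxAl dotrZl dotrZr -/q.
  have -> : sigma ^+ 2 / 8 / nw ^+ 2 * (t * nw) ^+ 2 = t ^+ 2 * (sigma ^+ 2 / 8).
    by field; exact: lt0r_neq0.
  by section_lra.
have w'd : `|w *m J - w'| <= e2 by rewrite distrC ltW.
have e2t (x : 'rV[R]_n) : `|x - xbar| <= t * (nw + 1) -> `|x - xbar| < r1 ->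
    `|f x - ybar - (x - xbar) *m J| <= e2 * t.
  move=> xt xr1; have [_ _ _] := reg x xr1; move/le_trans; apply.
  by rewrite -mulrA ler_pM2l// ler_pdivrMl// [(nw + 1) * t]mulrC.
have fab : `|f a - b| <= 2 * e2 * t.
  have -> : f a - b = (f a - ybar - (a - xbar) *m J) + t *: (w *m J - w').
    rewrite axE -scalemxAl scalerBr /b opprD addrA.
    by rewrite [RHS]addrA subrK.
  apply: le_trans (ler_normD _ _) _.
  have := e2t a; rewrite ax => /(_ tnw) fa2.
  have : `|t *: (w *m J - w')| <= t * e2 by rewrite normrZ gtr0_norm// ler_pM2l.
  have ar1' : t * nw < r1 by exact: le_lt_trans t1.
  by move: (fa2 ar1'); section_lra.
have test : penalized rho eta 1 a b (a, b) <= ell xbar + sigma ^+ 2 * t ^+ 2.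
  exact: (penalized_test_point (ltW rho0) (ltW e20) e21 e2m etaE t0 ell_a fab gapb_le).
have cont x : `|x - xbar| <= r' -> f @ x --> f x /\ ell @ x --> ell x.
  by move=> xr; have [[_ _ fx ellx] _ _ _] := reg x (le_lt_trans xr r'r1).
have [[x y] [/= xr yr y_dom pmin]] := penalized_min_exists rho eta 1 a b (ltW r'0) cont.
have w'J : `|w'| <= wJ + 1.
  rewrite -[w'](subrK (w *m J)) (le_trans (ler_normD _ _))// addrC lerD2l.
  exact: le_trans (ltW w'e) e21.
have b_r : `|b - ybar| <= r'.
  rewrite byE normrZ gtr0_norm// (le_trans _ (ltW t4))// ler_pM2l//.
  by move: w'J; section_lra.
have a_r : `|a - xbar| <= r' by rewrite ax (le_trans tnw)// ltW.
(* Without the localizing terms the penalized function is at least [ell xbar]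
  by exact penalization, so these terms are at most [sigma^2 t^2]. *)
have dist : dotr (x - a) (x - a) + dotr (y - b) (y - b) <= (sigma * t) ^+ 2.
  have := le_trans (pmin a b a_r b_r b_dom) test.
  have := pen_ge x y _ _ y_dom; rewrite (le_trans xr) ?ge_min ?lexx//.
  rewrite (le_trans yr) ?ge_min ?lexx// => /(_ isT isT).
  by rewrite /penalized exprMn /=; section_lra.
have st0 : 0 <= sigma * t by rewrite mulr_ge0// ltW.
have xa : `|x - a| <= sigma * t.
  rewrite -(ler_pXn2r (n := 2)) ?nnegrE//.
  by move: (normsq_le_dotr (x - a)) (dotr_ge0 (y - b)) dist; section_lra.
have yb : `|y - b| <= sigma * t.
  rewrite -(ler_pXn2r (n := 2)) ?nnegrE//.
  by move: (normsq_le_dotr (y - b)) (dotr_ge0 (x - a)) dist; section_lra.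
have sigt : sigma * t <= t by rewrite ler_piMl// ltW.
have xt : `|x - xbar| <= t * (nw + 1).
  rewrite -(subrKA a) (le_trans (ler_normD _ _))// ax.
  by move: xa sigt; section_lra.
have yt : `|y - ybar| <= t * (wJ + 2).
  rewrite -(subrKA b) (le_trans (ler_normD _ _))// byE normrZ gtr0_norm//.
  have : t * `|w'| <= t * (wJ + 1) by rewrite ler_pM2l.
  by move: yb sigt; section_lra.
have pnear : \forall p \near (x, y), edom theta p.2 ->
    penalized rho eta 1 a b (x, y) <= penalized rho eta 1 a b p.
  have x1 : (fun p : 'rV[R]_n * 'rV[R]_m => p.1) @ nbhs (x, y) --> x by exact: cvg_fst.
  have y1 : (fun p : 'rV[R]_n * 'rV[R]_m => p.2) @ nbhs (x, y) --> y by exact: cvg_snd.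
  have xn : \forall p \near (x, y), `|p.1 - xbar| < r'.
    exact: (x1 _ (near_norm_lt_open (le_lt_trans xt t2))).
  have yn : \forall p \near (x, y), `|p.2 - ybar| < r'.
    exact: (y1 _ (near_norm_lt_open (le_lt_trans yt t4))).
  apply: filterS2 xn yn => -[x' y'] /= x'r y'r y'_dom.
  by apply: pmin => //; exact: ltW.
have [[dfx dellx _ _] [CJx CJbar] _ fx] := reg x (le_lt_trans xt t1).
have [] := penalized_stationary dfx dellx y_dom pnear.
rewrite mulr1; set l := lb + _ - _ => lsub lgrad.
have llb : l - lb = rho *: (f x - y) - 2 *: (y - b).
  by rewrite /l addrAC [lb + _]addrC addrK.
have fxy : `|f x - y| <= K * sigma * t.
  have -> : f x - y = (f x - ybar - (x - xbar) *m J) + (x - a) *m J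
      + t *: (w *m J - w') - (y - b).
    have -> : x - xbar = (x - a) + t *: w by rewrite -axE subrKA.
    rewrite mulmxDl -scalemxAl scalerBr /b.
    move: ((x - a) *m J) (t *: (w *m J)) (t *: w') => u1 u2 u3.
    by apply/rowP => i; rewrite !mxE; ring.
  apply: le_trans (ler_normB _ _) _; apply: le_trans (lerD (ler_normD _ _) yb) _.
  apply: le_trans (lerD (lerD (ler_normD _ _) (lexx _)) (lexx _)) _.
  have h1 := e2t x xt (le_lt_trans xt t1).
  have h2 : `|(x - a) *m J| <= C * (sigma * t).
    by apply: le_trans (CJbar _) _; rewrite ler_wpM2l.
  have h3 : `|t *: (w *m J - w')| <= t * e2 by rewrite normrZ gtr0_norm// ler_pM2l.
  have h4 : e2 * t <= sigma * t by rewrite ler_pM2r.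
  have h5 : 0 <= (nw + 1) / Nw * (sigma * t) by rewrite mulr_ge0.
  have h6 : 0 <= C * (sigma * t) by rewrite mulr_ge0.
  rewrite /K; move: h1 h2 h3 h4 h5 h6 st0; section_lra.
have grad_le : `|grad_lagrangian phi0 f x l| <= K * sigma * t.
  rewrite lgrad normrN; apply: le_trans (ler_normD _ _) _.
  apply: le_trans (lerD (ler_normD _ _) (lexx _)) _.
  have eta2 : 0 < 2 * eta by exact: mulr_gt0.
  have two_gt0 : (0 : R) < 2 by [].
  rewrite -scalemxAl (normrZ (2 * eta)) (gtr0_norm eta2).
  rewrite !(normrZ 2) (gtr0_norm two_gt0).
  have h1 : 2 * eta * `|x - xbar| <= (nw + 1) / Nw * (sigma * t).
    have -> : 2 * eta = sigma ^+ 2 / Nw by rewrite /eta; field; exact: lt0r_neq0.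
    have -> : (nw + 1) / Nw * (sigma * t) = sigma / Nw * (t * (nw + 1)) by ring.
    by apply: ler_pM => //; rewrite ?divr_ge0 ?sqr_ge0 ?(ltW Nw0)// ler_pM2r ?invr_gt0.
  have h2 : `|(y - b) *m ('J f x)^T| <= C * (sigma * t).
    by apply: le_trans (CJx _) _; rewrite ler_wpM2l.
  have two0 : (0 : R) <= 2 by [].
  apply: le_trans (lerD (lerD h1 (ler_wpM2l two0 xa)) (ler_wpM2l two0 h2)) _.
  by rewrite /K; move: st0; section_lra.
have le : `|l - lb| < e.
  rewrite llb; apply: le_lt_trans (ler_normB _ _) _.
  rewrite !normrZ !gtr0_norm//; apply: le_lt_trans t5.
  have h1 : rho * `|f x - y| <= rho * (K * sigma * t) by rewrite ler_pM2l.
  have h2 : rho * K * (sigma * t) <= rho * K * t by rewrite ler_pM2l ?mulr_gt0.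
  by move: h1 h2 yb sigt; section_lra.
have m1 : `|x - xbar| <= `|(x - xbar, l - lb)|.
  by have := lexx `|(x - xbar, l - lb)|; rewrite pair_norm_le => /andP[].
have m2 := le_trans m1 (res x y l (le_lt_trans xt t3) le lsub).
suff lt : kappa * `|(grad_lagrangian phi0 f x l, y - f x)| < `|x - xbar|.
  by have := le_lt_trans m2 lt; rewrite ltxx.
rewrite prod_normE /=.
have Kst : Num.max `|grad_lagrangian phi0 f x l| `|y - f x| <= K * sigma * t.
  by rewrite ge_max grad_le distrC.
apply: (@le_lt_trans _ _ (kappa * (K * sigma * t))); first by rewrite ler_pM2l.
have lower : t * nw - sigma * t <= `|x - xbar|.
  rewrite -ax lerBlDr; apply: le_trans (_ : `|x - xbar| + `|x - a| <= _).
    by rewrite (distrC x a) [leRHS]addrC; exact: ler_distD.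
  by rewrite lerD2l.
apply: lt_le_trans lower.
have h1 : kappa * K * sigma * t < nw / 2 * t by rewrite ltr_pM2r.
have h2 : sigma * t <= nw / 2 * t by rewrite ler_pM2r.
by move: h1 h2; section_lra.
Unshelve. all: by end_near. Qed.

End Necessity.

(** * The equivalence *)

(** A derivative of the subdifferential in direction [0] is, up to a positive
  factor, the difference between a subgradient and [lb]; if it is annihilated by
  the transposed Jacobian matrix, this subgradient is a second multiplier. *)
Lemma unique_multiplier_strong_Robinson (R : realType) (n m : nat)
    (phi0 : 'rV[R]_n -> R) (f : 'rV[R]_n -> 'rV[R]_m)
    (theta : 'rV[R]_m -> \bar R) (xbar : 'rV[R]_n) (lb : 'rV[R]_m) :
  (forall y, (-oo < theta y)%E) -> econvex theta ->
  piecewise_linear_quadratic theta ->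
  grad_lagrangian phi0 f xbar lb = 0 ->
  subdifferential theta (f xbar) lb ->
  multipliers theta f xbar (- gradient phi0 xbar) = [set lb] ->
  strong_Robinson_CQ theta f xbar lb.
Proof.
move=> gtNy convex plq stationary lb_sub uniq.
apply/seteqP; split=> [mu [/= dmu muJ]|_ ->].
- have [s s0 lmu] := derivative_subgradient gtNy convex lb_sub plq dmu.
  have : multipliers theta f xbar (- gradient phi0 xbar) (lb + s *: mu).
    apply/(multipliersP theta stationary); split=> //.
    by rewrite addrAC subrr add0r -scalemxAl muJ scaler0.
  rewrite uniq /= => /eqP; rewrite -[eqbRHS]addr0 (inj_eq (addrI lb)).
  by rewrite scaler_eq0 (gt_eqF s0) => /eqP.
- split; last exact: mul0mx.
  exists (fun k => k.+1%:R^-1), (fun=> 0); split=> [k||//|k].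
  + by rewrite invr_gt0.
  + exact: cvg_harmonic.
  + exact: cvg_cst.
  + by rewrite scaler0 addr0.
Qed.

Unset Implicit Arguments.

Theorem theorem8p2 (R : realType) (n m : nat)
    (phi0 : 'rV[R]_n -> R) (f : 'rV[R]_n -> 'rV[R]_m)
    (theta : 'rV[R]_m -> \bar R)
    (xbar : 'rV[R]_n) (lambdabar : 'rV[R]_m)
    (phi0_C2 : C2_around phi0 xbar)
    (f_C2 : C2_around f xbar)
    (theta_gtNy : forall y, (-oo < theta y)%E)
    (theta_convex : econvex theta)
    (theta_plq : piecewise_linear_quadratic theta)
    (fxbar_dom : edom theta (f xbar))
    (KKT_stationary : grad_lagrangian phi0 f xbar lambdabar = 0)
    (KKT_subdiff : subdifferential theta (f xbar) lambdabar) :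
  [<-> strongly_metrically_subregular (KKT_mapping phi0 theta f)
           (xbar, lambdabar) (0, 0)
         /\ local_minimizer phi0 theta f xbar;
       multipliers theta f xbar (- gradient phi0 xbar) = [set lambdabar]
         /\ second_order_sufficient phi0 theta f xbar lambdabar;
       second_order_sufficient phi0 theta f xbar lambdabar
         /\ strong_Robinson_CQ theta f xbar lambdabar ].
Proof.
tfae.
- move=> [subr locmin]; split.
    exact: (subregular_unique_multiplier theta_gtNy KKT_stationary KKT_subdiff subr).
  exact: (subregular_sosc phi0_C2 f_C2 theta_gtNy theta_convex theta_plq
            KKT_stationary KKT_subdiff subr locmin).
- move=> [uniq sosc]; split=> //.
  exact: (unique_multiplier_strong_Robinson theta_gtNy theta_convex theta_plq
            KKT_stationary KKT_subdiff uniq).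
- move=> [sosc cq]; split.
    exact: (sosc_subregular phi0_C2 f_C2 theta_gtNy KKT_stationary KKT_subdiff
              theta_plq sosc cq).
  exact: (sosc_local_minimizer phi0_C2 f_C2 theta_gtNy KKT_stationary
            KKT_subdiff sosc).
Qed.
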